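(* Let $k$ be a field with a nonarchimedean absolute value $v:k\to\mathbb{R}_{\geq0}$, let $X=\operatorname{Spec}R$ be an affine $k$-scheme, and let $\iota:X\to T$ be a closed immersion of $k$-schemes into an affine toric variety $T=\operatorname{Spec}k[A]$. Let $X^{\mathrm{an}}$ be the Berkovich space of $X$, $X^{\mathrm{trop}}$ the tropicalization of $X$ along $v$ with respect to $\iota$, and $\mathrm{trop}:X^{\mathrm{an}}\to X^{\mathrm{trop}}$, $w\mapsto w\circ\iota_A^\sharp$, the Kajiwara–Payne tropicalization. Let $\mathbf k=k^{\mathrm{mon}}$, $\mathbf R=R^{\mathrm{mon}}$, $\mathbf X=\operatorname{Spec}\mathbf R$, let $\mathbf v:\mathbf k\to\mathbf T$ be the morphism given by $v$, let $B$ be the ordered blueprint associated with $\iota$, $Y=\operatorname{Spec}B$, and let $\beta_\ast:\operatorname{Trop}_{\mathbf v}(\mathbf X)(\mathbf T)\to\operatorname{Trop}_{\mathbf v}(Y)(\mathbf T)$ be the map induced by the $\mathbf T$-linear morphism $\beta:\operatorname{Trop}_{\mathbf v}(\mathbf X)\to\operatorname{Trop}_{\mathbf v}(Y)$ that is defined by the inclusion $B\to\mathbf R$. (All notions and topologies are defined in the context.) Then there are canonical homeomorphisms $$\Phi^{\mathrm{an}}:X^{\mathrm{an}}\to\operatorname{Trop}_{\mathbf v}(\mathbf X)(\mathbf T)\qquad\text{and}\qquad\Phi^{\mathrm{trop}}:X^{\mathrm{trop}}\to\operatorname{Trop}_{\mathbf v}(Y)(\mathbf T)$$ such that $$\bet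a_\ast\circ\Phi^{\mathrm{an}}=\Phi^{\mathrm{trop}}\circ\mathrm{trop}.$$
   Context: All rings, semirings and monoids are commutative; semirings have $0$ and $1$. Ordered blueprints. An ordered blueprint is a triple $B=(B^\bullet,B^+,\leq)$ where $B^+$ is a semiring, $B^\bullet\subset B^+$ is a multiplicatively closed subset containing $0,1$ that generates $B^+$ as a semiring, and $\leq$ is a partial order on $B^+$ that is additive and multiplicative ($x\leq y$ implies $x+z\leq y+z$ and $xz\leq yz$). The order is generated by a set of relations if it is the smallest additive and multiplicative partial order containing them. A morphism $B\to C$ is a multiplicative map $B^\bullet\to C^\bullet$ preserving $0$ and $1$ that extends (necessarily uniquely) to an order-preserving semiring homomorphism $B^+\to C^+$. An ordered blue $K$-algebra is an ordered blueprint $B$ with a morphism $K\to B$; $\operatorname{Hom}_K$ denotes morphisms commuting with the structure maps ($K$-linear morphisms). The tensor product $C\otimes_BD$ is the pushout of $C\leftarrow B\to D$ in the category of ordered blueprints. $\operatorname{Spec}B$ denotes the object of the opposite category corresponding to $B$. For a monoid with zero $M$ let $M^+$ be the semiring $\mathbb{N}[M]$ of finite formal sums of elements of $M$, modulo identifying $0\in M$ with the empty sum. For a ring $R$ with multiplicative monoid $R^\bullet$, $R^{\mathrm{mon}}=(R^\bullet,(R^\bullet)^+,\leq)$ with $\leq$ generated by the relations $c\leq a+b$ for $a,b,c\in R$ with $c=a+b$ in $R$. The tropical hyperfield is the ordered blueprint $\mathbf T$ with $\mathbf T^\bullet=(\mathbb{R}_{\geq0},\cdot)$, $\mathbf T^+=\mathbb{N}[\mathbb{R}_{>0}]=(\mathbf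 T^\bullet)^+$ and $\leq$ generated by the relations $c\leq a+b$ for all $a,b,c\in\mathbb{R}_{\geq0}$ such that the maximum among $a,b,c$ occurs (at least) twice. A nonarchimedean seminorm on a ring $R$ is a map $w:R\to\mathbb{R}_{\geq0}$ with $w(0)=0$, $w(1)=1$, $w(ab)=w(a)w(b)$, $w(a+b)\leq\max\{w(a),w(b)\}$; for a field this is a nonarchimedean absolute value. The map $v$, viewed as a map $\mathbf k^\bullet\to\mathbf T^\bullet$, is a morphism $\mathbf v:\mathbf k\to\mathbf T$. $X^{\mathrm{an}}$ is the set of nonarchimedean seminorms $w:R\to\mathbb{R}_{\geq0}$ whose composition with $k\to R$ equals $v$, with the coarsest topology making all evaluation maps $w\mapsto w(a)\in\mathbb{R}_{\geq0}$ ($a\in R$) continuous, $\mathbb{R}_{\geq0}$ having the Euclidean topology. $T=\operatorname{Spec}k[A]$ is an affine toric variety: $A$ is a (multiplicative) monoid that is finitely generated, integral (embeds into a group $G$) and saturated (if $A^{\mathrm{gp}}$ is the subgroup of $G$ generated by $A$, $a\in A^{\mathrm{gp}}$ and $a^n\in A$ for some $n\geq1$, then $a\in A$). $\iota^\sharp:k[A]\to R$ is the surjection corresponding to $\iota$, $\iota_A^\sharp:A\to R$ its restriction to $A$, and $I=\ker\iota^\sharp$. $\mathbb{R}_{\geq0}^A=\operatorname{Hom}(A,\mathbb{R}_{\geq0})$ is the set of multiplicative maps $f:A\to\mathbb{R}_{\geq0}$ with $f(1)=1$, with the coarsest topology making all evaluations $f\mapsto f(a)$ ($a\in A$) continuous.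 For a finite formal $\mathbb{R}_{\geq0}$-linear combination $p=\sum c_aa$ of elements $a\in A$, $Z(p)$ is the set of $f\in\mathbb{R}_{\geq0}^A$ such that the maximum occurs twice in $\{c_af(a)\}_{a\in A}$. For $p=\sum c_aa\in k[A]$ put $p^{\mathrm{trop}}=\sum v(c_a)a$. Then $X^{\mathrm{trop}}=\bigcap_{p\in I}Z(p^{\mathrm{trop}})$ with the subspace topology from $\mathbb{R}_{\geq0}^A$; the map $\mathrm{trop}$ takes values in it. The ordered blueprint $B$ associated with $\iota$: $B^\bullet=\{\iota^\sharp(ca)\mid c\in k,a\in A\}$ as a submonoid of $R$; $B^+=(B^\bullet)^+$; and $\leq$ is generated by all relations $\iota^\sharp(c_aa)\leq\sum_j\iota^\sharp(c_jb_j)$ (finite formal sums, with $c_a,c_j\in k$, $a,b_j\in A$) for which $\iota^\sharp(c_aa)=\sum_j\iota^\sharp(c_jb_j)$ in $R$. It is an ordered blue $\mathbf k$-algebra, and the inclusion $B^\bullet\subset R$ is a morphism $B\to\mathbf R$. $\operatorname{Trop}_{\mathbf v}(\mathbf X)=\operatorname{Spec}(\mathbf R\otimes_{\mathbf k}\mathbf T)$ and $\operatorname{Trop}_{\mathbf v}(Y)=\operatorname{Spec}(B\otimes_{\mathbf k}\mathbf T)$, with tensor products along $\mathbf v$. For an ordered blue $\mathbf T$-algebra $C$ and $Z=\operatorname{Spec}C$, $Z(\mathbf T)=\operatorname{Hom}_{\mathbf T}(C,\mathbf T)$ with the coarsest topology making all evaluation maps $f\mapsto f(a)\in\mathbf T=\mathbb{R}_{\geq0}$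 ($a\in C^\bullet$) continuous for the Euclidean topology on $\mathbb{R}_{\geq0}$. The map $\beta_\ast$ is composition with the morphism $B\otimes_{\mathbf k}\mathbf T\to\mathbf R\otimes_{\mathbf k}\mathbf T$ induced by the inclusion $B\to\mathbf R$. *)

(* Defs.v *)
From HB Require Import structures.
From mathcomp Require Import all_boot all_order all_algebra finmap.
From mathcomp Require Import generic_quotient interval_inference.
From mathcomp Require Import all_classical all_reals all_analysis.

Set Implicit Arguments.
Unset Strict Implicit.
Unset Printing Implicit Defensive.

Import Order.TTheory GRing.Theory Num.Theory.
Import numFieldNormedType.Exports.

Local Open Scope classical_set_scope.
Local Open Scope quotient_scope.
Local Open Scope ring_scope.

Record monalg (k : fieldType) (A : monoidType) := MonAlg {
  maval : {fsfun A -> k with 0} }.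

Section MonoidAlgebra.
Variables (k : fieldType) (A : monoidType).
Implicit Types (g h : monalg k A) (a b x : A) (c : k) (F : A -> k).

HB.instance Definition _ := [isNew for @maval k A].
HB.instance Definition _ := [Choice of monalg k A by <:].

Definition macoef g a : k := maval g a.
Definition masupp g : {fset A} := finsupp (maval g).

Definition monom c a : monalg k A := MonAlg [fsfun x in [fset a]%fset => c | 0].

Lemma monalgP g h : (forall a, macoef g a = macoef h a) -> g = h.
Proof. by move=> gh; apply: val_inj; apply/fsfunP. Qed.

Lemma macoef_monom c a x : macoef (monom c a) x = if x == a then c else 0.
Proof. by rewrite [LHS]fsfunE inE. Qed.

Lemma macoef_out g a : a \notin masupp g -> macoef g a = 0.
Proof. by move=> ?; rewrite /macoef fsfun_dflt. Qed.

Definition ma0 : monalg k A := MonAlg [fsfun].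
Definition maopp g : monalg k A :=
  MonAlg [fsfun a in masupp g => - macoef g a | 0].
Definition maadd g h : monalg k A :=
  MonAlg [fsfun a in (masupp g `|` masupp h)%fset => macoef g a + macoef h a | 0].
Definition mamul g h : monalg k A :=
  MonAlg [fsfun x in [fset (a * b)%g | a in masupp g, b in masupp h]%fset =>
    \sum_(a <- masupp g) macoef g a *
      \sum_(b <- masupp h) macoef h b * ((a * b)%g == x)%:R | 0].

Fact ma0E a : macoef ma0 a = 0. Proof. exact: fsfun0E. Qed.

Fact maoppE g a : macoef (maopp g) a = - macoef g a.
Proof. by rewrite [LHS]fsfunE; case: ifPn => // /macoef_out ->; rewrite oppr0. Qed.

Fact maaddE g h a : macoef (maadd g h) a = macoef g a + macoef h a.
Proof.
rewrite [LHS]fsfunE; case: ifPn => //; rewrite in_fsetU negb_or => /andP[gx hx].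
by rewrite !macoef_out ?addr0.
Qed.

Fact maaddA : associative maadd.
Proof. by move=> ? ? ?; apply: monalgP => a; rewrite !maaddE addrA. Qed.
Fact maaddC : commutative maadd.
Proof. by move=> ? ?; apply: monalgP => a; rewrite !maaddE addrC. Qed.
Fact maadd0 : left_id ma0 maadd.
Proof. by move=> ?; apply: monalgP => a; rewrite !maaddE ma0E add0r. Qed.
Fact maaddN : left_inverse ma0 maopp maadd.
Proof.
by move=> ?; apply: monalgP => a; rewrite maaddE maoppE ma0E addNr.
Qed.

HB.instance Definition _ :=
  GRing.isZmodule.Build (monalg k A) maaddA maaddC maadd0 maaddN.

Lemma macoefD g h a : macoef (g + h) a = macoef g a + macoef h a.
Proof. exact: maaddE. Qed.
Lemma macoef0 a : macoef (0 : monalg k A) a = 0. Proof. exact: ma0E. Qed.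
Lemma macoefN g a : macoef (- g) a = - macoef g a. Proof. exact: maoppE. Qed.

Definition mapair g F : k := \sum_(a <- masupp g) macoef g a * F a.

Fact mapairw (D : {fset A}) g F : (masupp g `<=` D)%fset ->
  mapair g F = \sum_(a <- D) macoef g a * F a.
Proof.
by move=> gD; apply: big_fset_incl => // a _ /macoef_out ->; rewrite mul0r.
Qed.

Fact mapairDl g h F : mapair (g + h) F = mapair g F + mapair h F.
Proof.
pose D := (masupp g `|` masupp h `|` masupp (g + h)%R)%fset.
rewrite !(@mapairw D) ?fsubsetUr //; first last.
- by rewrite /D -fsetUA fsubsetUl.
- by rewrite /D fsetUAC fsubsetUr.
by rewrite -big_split /=; apply: eq_bigr => a _; rewrite macoefD mulrDl.
Qed.

Fact mapairDr g F F' :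
  mapair g (fun a => F a + F' a) = mapair g F + mapair g F'.
Proof. by rewrite -big_split /=; apply: eq_bigr => a _; rewrite mulrDr. Qed.

Fact eq_mapair g F F' : F =1 F' -> mapair g F = mapair g F'.
Proof. by move=> FF'; apply: eq_bigr => a _; rewrite FF'. Qed.

Fact mapair_monom c a F : mapair (monom c a) F = c * F a.
Proof.
rewrite (@mapairw [fset a]%fset) ?big_seq_fset1 ?macoef_monom ?eqxx //.
apply/fsubsetP => x; rewrite mem_finsupp inE -[_ x]/(macoef _ x) macoef_monom.
by case: (x == a) => //; rewrite eqxx.
Qed.

Fact macoef_pair g x : macoef g x = mapair g (fun a => (a == x)%:R).
Proof.
rewrite (@mapairw (x |` masupp g)%fset) ?fsubsetUr //.
rewrite (big_fsetD1 x) ?fset1U1 //= eqxx mulr1 big1_seq ?addr0 //.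
by move=> a /=; rewrite !inE => /andP[/negPf -> _]; rewrite mulr0.
Qed.

Fact mamulE g h x : macoef (mamul g h) x =
  mapair g (fun a => mapair h (fun b => ((a * b)%g == x)%:R)).
Proof.
rewrite [LHS]fsfunE; case: ifPn => // xD.
rewrite /mapair big1_seq // => a /= ga; rewrite big1_seq ?mulr0 // => b /= hb.
case: eqP => [abx|]; last by rewrite mulr0.
by case/negP: xD; apply/imfset2P; exists a => //; exists b.
Qed.

Fact mapair_mul g h F :
  mapair (mamul g h) F = mapair g (fun a => mapair h (fun b => F (a * b)%g)).
Proof.
pose D := [fset (a * b)%g | a in masupp g, b in masupp h]%fset.
rewrite (@mapairw D); last first.
  apply/fsubsetP => x; apply: contraLR => xD.
  by rewrite mem_finsupp negbK fsfunE (negPf xD).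
under eq_bigr => x _ do rewrite mamulE mulr_suml.
rewrite exchange_big /=; apply: eq_big_seq => a ga.
under eq_bigr => x _ do rewrite -mulrA mulr_suml.
rewrite -big_distrr /= exchange_big /=; congr (_ * _).
apply: eq_big_seq => b hb.
have abD : (a * b)%g \in D by apply/imfset2P; exists a => //; exists b.
rewrite (big_fsetD1 _ abD) /= eqxx mulr1 big1_seq ?addr0 // => x /=.
by rewrite !inE eq_sym => /andP[/negPf -> _]; rewrite mulr0 mul0r.
Qed.

Fact mamulA : associative mamul.
Proof.
move=> g h l; apply: monalgP => x; rewrite !mamulE mapair_mul.
apply: eq_mapair => a; rewrite mapair_mul; apply: eq_mapair => b.
by apply: eq_mapair => c; rewrite mulgA.
Qed.
Fact mamul1l : left_id (monom 1 1%g) mamul.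
Proof.
move=> g; apply: monalgP => x; rewrite mamulE mapair_monom mul1r [RHS]macoef_pair.
by apply: eq_mapair => a; rewrite mul1g.
Qed.
Fact mamul1r : right_id (monom 1 1%g) mamul.
Proof.
move=> g; apply: monalgP => x; rewrite mamulE [RHS]macoef_pair.
by apply: eq_mapair => a; rewrite mapair_monom mul1r mulg1.
Qed.
Fact mamulDl : left_distributive mamul +%R.
Proof. by move=> g h l; apply: monalgP => x; rewrite macoefD !mamulE mapairDl. Qed.
Fact mamulDr : right_distributive mamul +%R.
Proof.
move=> g h l; apply: monalgP => x; rewrite macoefD !mamulE -mapairDr.
by apply: eq_mapair => a; rewrite mapairDl.
Qed.
Fact ma1_neq0 : monom 1 1%g != 0 :> monalg k A.
Proof.
apply/eqP => /(congr1 (macoef^~ 1%g)); rewrite macoef_monom eqxx macoef0.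
exact/eqP/oner_neq0.
Qed.

HB.instance Definition _ := GRing.Zmodule_isNzRing.Build (monalg k A)
  mamulA mamul1l mamul1r mamulDl mamulDr ma1_neq0.

Lemma monom1E : monom 1 1%g = 1 :> monalg k A. Proof. by []. Qed.

Lemma monomM c d a b : monom c a * monom d b = monom (c * d) (a * b)%g.
Proof.
apply: monalgP => x; rewrite [LHS]mamulE !mapair_monom macoef_monom eq_sym.
by case: eqP; rewrite ?mulr1 // !mulr0.
Qed.

Lemma monomD c d a : monom c a + monom d a = monom (c + d) a.
Proof.
by apply: monalgP => x; rewrite macoefD !macoef_monom; case: eqP; rewrite ?addr0.
Qed.

Lemma monom0 a : monom 0 a = 0.
Proof. by apply: monalgP => x; rewrite macoef_monom macoef0 if_same. Qed.

Lemma monalgE g : g = \sum_(a <- masupp g) monom (macoef g a) a.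
Proof.
apply: monalgP => x.
have -> : macoef (\sum_(a <- masupp g) monom (macoef g a) a) x =
    \sum_(a <- masupp g) macoef (monom (macoef g a) a) x.
  by elim/big_rec2: _ => [|a ? ? _ <-]; rewrite ?macoef0 ?macoefD.
rewrite macoef_pair; apply: eq_bigr => a _; rewrite macoef_monom eq_sym.
by case: eqP; rewrite ?mulr1 ?mulr0.
Qed.

End MonoidAlgebra.
Arguments monom {k A} c a.

Record monoid0 := Monoid0 {
  m0sort :> choiceType;
  m0mul : m0sort -> m0sort -> m0sort;
  m0one : m0sort;
  m0zero : m0sort;
  m0mulA : associative m0mul;
  m0mulC : commutative m0mul;
  m0mul1 : left_id m0one m0mul;
  m0mul0 : left_zero m0zero m0mul
}.
Arguments m0one {m}.
Arguments m0zero {m}.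

Section FormalSums.
Variable M : monoid0.
Implicit Types s t u : seq M.

(* A formal sum of elements of M is a sequence over M; the sum of two formal  *)
(* sums is concatenation and their product is fsmul.                          *)
Definition fsmul s t : seq M := [seq m0mul x y | x <- s, y <- t].

Record fscong := FSCong {
  fsc_rel :> rel (seq M);
  fsc_refl : reflexive fsc_rel;
  fsc_sym : symmetric fsc_rel;
  fsc_trans : transitive fsc_rel;
  fsc_perm : forall s t, perm_eq s t -> fsc_rel s t;
  fsc_cat : forall s t u, fsc_rel s t -> fsc_rel (s ++ u) (t ++ u);
  fsc_mul : forall s t u, fsc_rel s t -> fsc_rel (fsmul s u) (fsmul t u)
}.

Definition fsc_equiv (e : fscong) :=
  EquivRel e (@fsc_refl e) (@fsc_sym e) (@fsc_trans e).

Definition fsquot (e : fscong) : Type := {eq_quot (fsc_equiv e)}.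

Lemma fsmulA : associative fsmul.
Proof.
move=> s t u; elim: s => //= x s IHs.
rewrite /fsmul !allpairs_cons allpairs_cat -!/(fsmul _ _) IHs; congr (_ ++ _).
rewrite /fsmul map_allpairs allpairs_mapl.
by apply: eq_allpairs => y z; rewrite m0mulA.
Qed.

Lemma fsmul_permC s t : perm_eq (fsmul s t) (fsmul t s).
Proof.
elim: s t => [|x s IHs] t; first by rewrite /fsmul allpairs0r.
rewrite perm_sym perm_allpairs_consr.
rewrite /fsmul allpairs_cons; apply: perm_cat; last by rewrite perm_sym; exact: IHs.
by under eq_map do rewrite m0mulC.
Qed.

Lemma fsmul1 s : fsmul [:: m0one] s = s.
Proof.
rewrite /fsmul allpairs1l; under eq_map do rewrite m0mul1.
exact: map_id.
Qed.

Section Quotient.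
Variable e : fscong.
Local Notation Q := (fsquot e).

HB.instance Definition _ := Choice.copy Q {eq_quot (fsc_equiv e)}.

Definition fsclass s : Q := \pi_{eq_quot (fsc_equiv e)} s.
Definition fsrepr (x : Q) : seq M := repr (x : {eq_quot (fsc_equiv e)}).

Lemma fsreprK x : fsclass (fsrepr x) = x. Proof. exact: reprK. Qed.
Lemma fsclassP s t : reflect (fsclass s = fsclass t) (e s t).
Proof. exact: (@eqmodP _ (fsc_equiv e) s t). Qed.
Lemma fsclassK s : e (fsrepr (fsclass s)) s.
Proof. by apply/fsclassP; rewrite fsreprK. Qed.

Definition fsq_add (x y : Q) := fsclass (fsrepr x ++ fsrepr y).
Definition fsq_mul (x y : Q) := fsclass (fsmul (fsrepr x) (fsrepr y)).

Lemma fsc_cat2 s s' t t' : e s s' -> e t t' -> e (s ++ t) (s' ++ t').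
Proof.
move=> ss' tt'; apply: (@fsc_trans e (s' ++ t)); first exact: fsc_cat.
apply: (@fsc_trans e (t ++ s')); first by apply: fsc_perm; rewrite perm_catC.
apply: (@fsc_trans e (t' ++ s')); first exact: fsc_cat.
by apply: fsc_perm; rewrite perm_catC.
Qed.

Lemma fsc_mul2 s s' t t' : e s s' -> e t t' -> e (fsmul s t) (fsmul s' t').
Proof.
move=> ss' tt'; apply: (@fsc_trans e (fsmul s' t)); first exact: fsc_mul.
apply: (@fsc_trans e (fsmul t s')); first exact/fsc_perm/fsmul_permC.
apply: (@fsc_trans e (fsmul t' s')); first exact: fsc_mul.
exact/fsc_perm/fsmul_permC.
Qed.

Lemma fsq_addE s t : fsq_add (fsclass s) (fsclass t) = fsclass (s ++ t).
Proof. by apply/fsclassP; apply: fsc_cat2; exact: fsclassK. Qed.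
Lemma fsq_mulE s t : fsq_mul (fsclass s) (fsclass t) = fsclass (fsmul s t).
Proof. by apply/fsclassP; apply: fsc_mul2; exact: fsclassK. Qed.

Fact fsq_ind (P : Q -> Prop) : (forall s, P (fsclass s)) -> forall x, P x.
Proof. by move=> Ps x; rewrite -[x]fsreprK. Qed.

Fact fsq_addA : associative fsq_add.
Proof.
by elim/fsq_ind=> s; elim/fsq_ind=> t; elim/fsq_ind=> u; rewrite !fsq_addE catA.
Qed.
Fact fsq_addC : commutative fsq_add.
Proof.
elim/fsq_ind=> s; elim/fsq_ind=> t; rewrite !fsq_addE; apply/fsclassP.
by apply: fsc_perm; rewrite perm_catC.
Qed.
Fact fsq_add0 : left_id (fsclass [::]) fsq_add.
Proof. by elim/fsq_ind=> s; rewrite fsq_addE. Qed.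

HB.instance Definition _ := GRing.isNmodule.Build Q fsq_addA fsq_addC fsq_add0.

Fact fsq_mulA : associative fsq_mul.
Proof.
by elim/fsq_ind=> s; elim/fsq_ind=> t; elim/fsq_ind=> u; rewrite !fsq_mulE fsmulA.
Qed.
Fact fsq_mulC : commutative fsq_mul.
Proof.
elim/fsq_ind=> s; elim/fsq_ind=> t; rewrite !fsq_mulE; apply/fsclassP.
exact/fsc_perm/fsmul_permC.
Qed.
Fact fsq_mul1 : left_id (fsclass [:: m0one]) fsq_mul.
Proof. by elim/fsq_ind=> s; rewrite fsq_mulE fsmul1. Qed.
Fact fsq_mulDl : left_distributive fsq_mul +%R.
Proof.
elim/fsq_ind=> s; elim/fsq_ind=> t; elim/fsq_ind=> u; rewrite -[_ + _]/(fsq_add _ _).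
by rewrite -[RHS]/(fsq_add _ _) fsq_addE !fsq_mulE fsq_addE /fsmul allpairs_cat.
Qed.
Fact fsq_mul0 : left_zero 0 fsq_mul.
Proof. by elim/fsq_ind=> s; rewrite -[0]/(fsclass [::]) fsq_mulE. Qed.

HB.instance Definition _ :=
  GRing.Nmodule_isComPzSemiRing.Build Q fsq_mulA fsq_mulC fsq_mul1 fsq_mulDl fsq_mul0.

Lemma fsclass0 : fsclass [::] = 0. Proof. by []. Qed.
Lemma fsclass1 : fsclass [:: m0one] = 1. Proof. by []. Qed.
Lemma fsclassD s t : fsclass (s ++ t) = fsclass s + fsclass t.
Proof. by rewrite -fsq_addE. Qed.
Lemma fsclassM s t : fsclass (fsmul s t) = fsclass s * fsclass t.
Proof. by rewrite -fsq_mulE. Qed.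
Lemma fsclassE s : fsclass s = \sum_(x <- s) fsclass [:: x].
Proof.
elim: s => [|x s IHs]; first by rewrite big_nil.
by rewrite big_cons -IHs -fsclassD.
Qed.

End Quotient.

Section Lift.
Variables (e : fscong) (P : comPzSemiRingType).

Record fsmor := FSMor {
  fsm_fun :> M -> P;
  fsm1 : fsm_fun m0one = 1;
  fsmM : {morph fsm_fun : x y / m0mul x y >-> x * y};
  fsm_compat : forall s t, e s t ->
    \sum_(x <- s) fsm_fun x = \sum_(x <- t) fsm_fun x
}.

Definition fslift (F : fsmor) (x : fsquot e) : P := \sum_(y <- fsrepr x) F y.

Lemma fsliftE F s : fslift F (fsclass e s) = \sum_(x <- s) F x.
Proof. exact/fsm_compat/fsclassK. Qed.

Lemma fssumM F s t :
  \sum_(x <- fsmul s t) fsm_fun F x = (\sum_(x <- s) F x) * \sum_(x <- t) F x.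
Proof.
rewrite /fsmul big_flatten /= big_map mulr_suml; apply: eq_bigr => x _.
by rewrite big_map mulr_sumr; apply: eq_bigr => y _; rewrite fsmM.
Qed.

Fact fslift_add F : nmod_morphism (fslift F).
Proof.
split; first by rewrite -fsclass0 fsliftE big_nil.
move=> x y; rewrite -[x]fsreprK -[y]fsreprK -fsclassD !fsliftE.
by rewrite big_cat.
Qed.
Fact fslift_mul F : monoid_morphism (fslift F).
Proof.
split; first by rewrite -fsclass1 fsliftE big_seq1 fsm1.
by move=> x y; rewrite -[x]fsreprK -[y]fsreprK -fsclassM !fsliftE fssumM.
Qed.

HB.instance Definition _ F := GRing.isNmodMorphism.Build _ _ (fslift F) (fslift_add F).
HB.instance Definition _ F := GRing.isMonoidMorphism.Build _ _ (fslift F) (fslift_mul F).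

End Lift.

Definition fs_nz s : seq M := [seq x <- s | x != m0zero].

Lemma fs_nz_mul s t : fs_nz (fsmul s t) = fs_nz (fsmul (fs_nz s) t).
Proof.
elim: s => //= x s IHs; rewrite /fsmul allpairs_cons /fs_nz filter_cat.
rewrite -!/(fs_nz _) -!/(fsmul _ _) IHs; case: eqVneq => [->|x0] /=.
  rewrite [X in X ++ _](_ : _ = [::]) //; apply/eqP.
  rewrite -size_eq0 size_filter -leqn0 leqNgt -has_count.
  by apply/hasPn => _ /mapP[y _ ->]; rewrite m0mul0 eqxx.
by rewrite /fsmul allpairs_cons /fs_nz filter_cat.
Qed.

Definition m0plus_rel s t := perm_eq (fs_nz s) (fs_nz t).
Fact m0plus_refl : reflexive m0plus_rel. Proof. by move=> s; exact: perm_refl. Qed.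
Fact m0plus_sym : symmetric m0plus_rel. Proof. by move=> s t; exact: perm_sym. Qed.
Fact m0plus_trans : transitive m0plus_rel. Proof. by move=> s t u; exact: perm_trans. Qed.
Fact m0plus_perm s t : perm_eq s t -> m0plus_rel s t.
Proof. exact: perm_filter. Qed.
Fact m0plus_cat s t u : m0plus_rel s t -> m0plus_rel (s ++ u) (t ++ u).
Proof. by rewrite /m0plus_rel /fs_nz !filter_cat perm_cat2r. Qed.
Fact m0plus_mul s t u : m0plus_rel s t -> m0plus_rel (fsmul s u) (fsmul t u).
Proof.
rewrite /m0plus_rel fs_nz_mul [fs_nz (fsmul t u)]fs_nz_mul => st.
by apply/perm_filter/perm_allpairs_dep.
Qed.

(* Formal sums up to reordering and removal of the terms equal to 0. *)
Definition m0plus_cong : fscong :=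
  FSCong m0plus_refl m0plus_sym m0plus_trans m0plus_perm m0plus_cat m0plus_mul.

End FormalSums.

Definition m0plus (M : monoid0) : comPzSemiRingType := fsquot (m0plus_cong M).
Definition m0single (M : monoid0) (x : M) : m0plus M :=
  fsclass (m0plus_cong M) [:: x].

Definition additive_multiplicative_porder (P : comPzSemiRingType)
    (le : P -> P -> Prop) : Prop :=
  [/\ forall x, le x x,
      forall x y, le x y -> le y x -> x = y,
      forall x y z, le x y -> le y z -> le x z,
      forall x y z, le x y -> le (x + z) (y + z)
    & forall x y z, le x y -> le (x * z) (y * z)].

(* The smallest additive and multiplicative partial order containing G. *)
Definition generated_order (P : comPzSemiRingType) (G : P -> P -> Prop)
    (x y : P) : Prop :=
  forall le, additive_multiplicative_porder le ->
    (forall a b, G a b -> le a b) -> le x y.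

Lemma generated_order_base (P : comPzSemiRingType) (G : P -> P -> Prop) x y :
  G x y -> generated_order G x y.
Proof. by move=> Gxy le _; exact. Qed.

(* The inclusion of the underlying monoid into the ambient semiring is the    *)
(* injective map ob_incl; ob_gen says that its image generates ob_plus.       *)
Record oblpr := OBlpr {
  ob_bullet :> monoid0;
  ob_plus : comPzSemiRingType;
  ob_incl : ob_bullet -> ob_plus;
  ob_incl_inj : injective ob_incl;
  ob_incl0 : ob_incl m0zero = 0;
  ob_incl1 : ob_incl m0one = 1;
  ob_inclM : {morph ob_incl : x y / m0mul x y >-> x * y};
  ob_gen : forall H : set ob_plus, H 0 -> H 1 ->
    (forall x y, H x -> H y -> H (x + y)) ->
    (forall x y, H x -> H y -> H (x * y)) ->
    (forall b, H (ob_incl b)) -> forall x, H x;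
  ob_le : ob_plus -> ob_plus -> Prop;
  ob_le_porder : additive_multiplicative_porder ob_le
}.
Arguments ob_incl {o} b.
Arguments ob_le {o} x y.

Record ohom (B C : oblpr) := OHom {
  oh_fun :> B -> C;
  oh0 : oh_fun m0zero = m0zero;
  oh1 : oh_fun m0one = m0one;
  ohM : {morph oh_fun : x y / m0mul x y >-> m0mul x y};
  oh_ext : exists g : {rmorphism ob_plus B -> ob_plus C},
    (forall b, g (ob_incl b) = ob_incl (oh_fun b)) /\
    (forall x y, ob_le x y -> ob_le (g x) (g y))
}.

Lemma ohomP B C (f g : ohom B C) : (forall b, f b = g b) -> f = g.
Proof.
case: f g => [f f0 f1 fM fe] [g g0 g1 gM ge] /= /funext fg.
by subst g; congr OHom; exact: Prop_irrelevance.
Qed.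

Section Hom.

Fact oid_ext (B : oblpr) : exists g : {rmorphism ob_plus B -> ob_plus B},
  (forall b : B, g (ob_incl b) = ob_incl b) /\
  (forall x y, ob_le x y -> ob_le (g x) (g y)).
Proof. by exists idfun. Qed.

Definition oid (B : oblpr) : ohom B B :=
  @OHom B B id erefl erefl (fun _ _ => erefl) (oid_ext B).

Variables (B C D : oblpr) (g : ohom C D) (f : ohom B C).

Fact ocomp0 : g (f m0zero) = m0zero. Proof. by rewrite !oh0. Qed.
Fact ocomp1 : g (f m0one) = m0one. Proof. by rewrite !oh1. Qed.
Fact ocompM : {morph g \o f : x y / m0mul x y >-> m0mul x y}.
Proof. by move=> x y /=; rewrite !ohM. Qed.
Fact ocomp_ext : exists h : {rmorphism ob_plus B -> ob_plus D},
  (forall b, h (ob_incl b) = ob_incl (g (f b))) /\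
  (forall x y, ob_le x y -> ob_le (h x) (h y)).
Proof.
have [g' [g'E g'le]] := oh_ext g; have [f' [f'E f'le]] := oh_ext f.
exists (g' \o f'); split=> [b|x y /f'le /g'le //].
by rewrite /= f'E g'E.
Qed.

Definition ocomp : ohom B D := OHom ocomp0 ocomp1 ocompM ocomp_ext.

End Hom.

Record oalg (K : oblpr) := OAlg { oa_obj :> oblpr; oa_str : ohom K oa_obj }.

Record ohomK (K : oblpr) (C D : oalg K) := OHomK {
  ohk_hom :> ohom C D;
  ohk_lin : forall a : K, ohk_hom (oa_str C a) = oa_str D a
}.

Lemma ohomKP K (C D : oalg K) (f g : ohomK C D) : (forall b, f b = g b) -> f = g.
Proof.
case: f g => [f fl] [g gl] /= fg.
have {}fg : f = g by exact: ohomP.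
by subst g; congr OHomK; exact: Prop_irrelevance.
Qed.

Section AlgebraMaps.
Variable K : oblpr.

Definition oalg_self : oalg K := OAlg (oid K).

Variables (C D E : oalg K) (g : ohomK D E) (f : ohomK C D).

Fact ocompK_lin a : ocomp g f (oa_str C a) = oa_str E a.
Proof. by rewrite /= !ohk_lin. Qed.

Definition ocompK : ohomK C E := OHomK ocompK_lin.

End AlgebraMaps.

Lemma ob_sum (B : oblpr) (x : ob_plus B) :
  exists s : seq B, x = \sum_(b <- s) ob_incl b.
Proof.
move: x; apply: ob_gen.
- by exists [::]; rewrite big_nil.
- by exists [:: m0one]; rewrite big_seq1 ob_incl1.
- by move=> _ _ [s ->] [t ->]; exists (s ++ t); rewrite big_cat.
- move=> _ _ [s ->] [t ->]; exists (fsmul s t).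
  rewrite /fsmul big_flatten /= big_map mulr_suml; apply: eq_bigr => x _.
  by rewrite big_map mulr_sumr; apply: eq_bigr => y _; rewrite ob_inclM.
- by move=> b; exists [:: b]; rewrite big_seq1.
Qed.

Section FreeBlueprint.
Variable M : monoid0.
Implicit Types x y z : m0plus M.

Lemma m0single_inj : injective (@m0single M).
Proof.
move=> a b /fsclassP /=; rewrite /m0plus_rel /fs_nz /=.
case: eqVneq => [->|a0]; case: eqVneq => [->|b0] //= /perm_mem.
- by move=> /(_ b); rewrite !inE eqxx.
- by move=> /(_ a); rewrite !inE eqxx.
- by move=> /(_ a); rewrite !inE eqxx => /esym/eqP.
Qed.

Lemma m0single0 : m0single (@m0zero M) = 0.
Proof. by apply/fsclassP; rewrite /= /m0plus_rel /fs_nz /= eqxx. Qed.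

Lemma m0singleM : {morph @m0single M : x y / m0mul x y >-> x * y}.
Proof. by move=> a b; rewrite -fsclassM. Qed.

Lemma m0plus_sum x : exists s : seq M, x = \sum_(a <- s) m0single a.
Proof. by exists (fsrepr x); rewrite -fsclassE fsreprK. Qed.

Lemma m0plus_gen (H : set (m0plus M)) : H 0 -> H 1 ->
    (forall x y, H x -> H y -> H (x + y)) ->
    (forall x y, H x -> H y -> H (x * y)) ->
    (forall a, H (m0single a)) -> forall x, H x.
Proof.
move=> H0 _ HD _ HM x; have [s ->] := m0plus_sum x.
by elim/big_ind: _ => // a _.
Qed.

Definition m0len x : nat := size (fs_nz (fsrepr x)).

Lemma m0lenE s : m0len (fsclass (m0plus_cong M) s) = size (fs_nz s).
Proof. exact/perm_size/(fsclassK (m0plus_cong M) s). Qed.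

Lemma m0lenD x y : m0len (x + y) = (m0len x + m0len y)%N.
Proof.
rewrite -[x]fsreprK -[y]fsreprK -fsclassD !m0lenE.
by rewrite /fs_nz filter_cat size_cat.
Qed.

Lemma m0len_single a : m0len (m0single a) = (a != m0zero).
Proof. by rewrite m0lenE /fs_nz /=; case: ifP. Qed.

(* Relations that never shorten a formal sum, and only preserve the length of *)
(* equal ones, generate a partial order.                                      *)
Definition expanding (G : m0plus M -> m0plus M -> Prop) : Prop :=
  (forall x y a, G x y -> G (x * m0single a) (y * m0single a)) /\
  (forall x y, G x y -> x = y \/ (m0len x < m0len y)%N).

Definition m0len_le x y : Prop :=
  forall z, x * z = y * z \/ (m0len (x * z) < m0len (y * z))%N.

Fact m0len_le_porder : additive_multiplicative_porder m0len_le.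
Proof.
split.
- by move=> x z; left.
- move=> x y /(_ 1)[|xy]; rewrite ?mulr1 // => /(_ 1)[|yx]; rewrite ?mulr1 //.
  by move: xy yx; rewrite !mulr1 => /ltn_trans h /h; rewrite ltnn.
- move=> x y z xy yz t; case: (xy t) => [->|l1]; first exact: yz.
  case: (yz t) => [<-|l2]; first by right.
  by right; exact: ltn_trans l2.
- move=> x y z xy t; rewrite !mulrDl !m0lenD ltn_add2r.
  by case: (xy t) => [->|]; [left|right].
- by move=> x y z xy t; rewrite -!mulrA; exact: xy.
Qed.

Fact m0len_le_gen G x y : expanding G -> G x y -> m0len_le x y.
Proof.
move=> [GM Glen] Gxy z; have [s ->] := m0plus_sum z.
elim: s => [|a s IHs]; first by left; rewrite big_nil !mulr0.
rewrite big_cons !mulrDr !m0lenD; case: IHs => [->|l].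
  by case: (Glen _ _ (GM _ _ a Gxy)) => [->|?]; [left|right; rewrite ltn_add2r].
right; case: (Glen _ _ (GM _ _ a Gxy)) => [->|?]; first by rewrite ltn_add2l.
by rewrite -addnS leq_add // ltnW.
Qed.

Lemma generated_order_porder G : expanding G ->
  additive_multiplicative_porder (generated_order G).
Proof.
move=> eG; split.
- by move=> x le [].
- move=> x y xy yx; have [_ anti _ _ _] := m0len_le_porder.
  have gen a b : G a b -> m0len_le a b by exact: m0len_le_gen.
  by apply: anti; [exact: (xy _ m0len_le_porder)|exact: (yx _ m0len_le_porder)].
- move=> x y z xy yz le ple Gle; have [_ _ tr _ _] := ple.
  by apply: (tr _ y); [exact: xy|exact: yz].
- move=> x y z xy le ple Gle; have [_ _ _ ad _] := ple.
  by apply: ad; exact: xy.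
- move=> x y z xy le ple Gle; have [_ _ _ _ mu] := ple.
  by apply: mu; exact: xy.
Qed.

Definition free_oblpr G (eG : expanding G) : oblpr :=
  OBlpr m0single_inj m0single0 (fsclass1 _) m0singleM m0plus_gen
    (generated_order_porder eG).

End FreeBlueprint.

Section FreeHom.
Variables (M : monoid0) (G : m0plus M -> m0plus M -> Prop).
Hypothesis eG : expanding G.
Variables (C : oblpr) (f : M -> C).
Hypotheses (f0 : f m0zero = m0zero) (f1 : f m0one = m0one).
Hypothesis fM : {morph f : x y / m0mul x y >-> m0mul x y}.
Hypothesis fG : forall x y, G x y -> exists s t : seq M,
  [/\ x = \sum_(a <- s) m0single a, y = \sum_(a <- t) m0single a
    & ob_le (\sum_(a <- s) ob_incl (f a)) (\sum_(a <- t) ob_incl (f a))].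

Definition free_fun a : ob_plus C := ob_incl (f a).
Fact free_fun1 : free_fun m0one = 1. Proof. by rewrite /free_fun f1 ob_incl1. Qed.
Fact free_funM : {morph free_fun : x y / m0mul x y >-> x * y}.
Proof. by move=> x y; rewrite /free_fun fM ob_inclM. Qed.
Fact free_fun_nz s : \sum_(a <- s) free_fun a = \sum_(a <- fs_nz s) free_fun a.
Proof.
rewrite /fs_nz big_filter [RHS]big_mkcond /=; apply: eq_bigr => a _.
by case: eqVneq => [->|] //=; rewrite /free_fun f0 ob_incl0.
Qed.
Fact free_fun_compat s t : m0plus_cong M s t -> \sum_(a <- s) free_fun a = \sum_(a <- t) free_fun a.
Proof. by move=> st; rewrite free_fun_nz [RHS]free_fun_nz; exact: perm_big. Qed.

Fact free_fun_ext : exists g : {rmorphism ob_plus (free_oblpr eG) -> ob_plus C},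
  (forall b : free_oblpr eG, g (ob_incl b) = ob_incl (f b)) /\
  (forall x y, ob_le x y -> ob_le (g x) (g y)).
Proof.
pose L : {rmorphism m0plus M -> ob_plus C} := fslift (FSMor free_fun1 free_funM free_fun_compat).
have LE s : L (\sum_(a <- s) m0single a) = \sum_(a <- s) free_fun a.
  by rewrite -fsclassE [LHS]fsliftE.
exists L; split=> [b|x y xy]; first by rewrite /= [LHS]fsliftE big_seq1.
have [re an tr ad mu] := ob_le_porder C.
have [re' an' tr' ad' mu'] := ob_le_porder (free_oblpr eG).
pose le' (x y : m0plus M) := ob_le (L x) (L y) /\ @ob_le (free_oblpr eG) x y.
suff [] : le' x y by [].
apply: xy; first split=> //.
  - by move=> a b [_ +] [_]; exact: an'.
  - by move=> a b c [ab ab'] [bc bc']; split; [exact: tr bc|exact: tr' bc'].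
  - by move=> a b c [ab ab']; split; [rewrite !(rmorphD L); exact: ad|exact: ad'].
  - by move=> a b c [ab ab']; split; [rewrite !(rmorphM L); exact: mu|exact: mu'].
move=> a b Gab; split; last by move=> le _; exact.
by have [s [t [-> -> st]]] := fG Gab; rewrite !LE.
Qed.

Definition free_ohom : ohom (free_oblpr eG) C :=
  @OHom (free_oblpr eG) C f f0 f1 fM free_fun_ext.

End FreeHom.

Section SubMonoid.
Variables (P : comPzSemiRingType) (U : set P).
Hypotheses (U0 : U 0) (U1 : U 1) (UM : forall x y, U x -> U y -> U (x * y)).

Definition sub_zero : U := exist _ 0 (mem_set U0).
Definition sub_one : U := exist _ 1 (mem_set U1).
Definition sub_mul (x y : U) : U :=
  exist _ (val x * val y) (mem_set (UM (set_valP x) (set_valP y))).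
Fact sub_mulA : associative sub_mul.
Proof. by move=> x y z; apply: val_inj; rewrite /= mulrA. Qed.
Fact sub_mulC : commutative sub_mul.
Proof. by move=> x y; apply: val_inj; rewrite /= mulrC. Qed.
Fact sub_mul1 : left_id sub_one sub_mul.
Proof. by move=> x; apply: val_inj; rewrite /= mul1r. Qed.
Fact sub_mul0 : left_zero sub_zero sub_mul.
Proof. by move=> x; apply: val_inj; rewrite /= mul0r. Qed.

Definition sub_monoid0 : monoid0 := Monoid0 sub_mulA sub_mulC sub_mul1 sub_mul0.

End SubMonoid.

Section Tensor.
Variables (K C D : oblpr) (f : ohom K C) (g : ohom K D).

Definition prod_mul (x y : C * D) : C * D := (m0mul x.1 y.1, m0mul x.2 y.2).
Fact prod_mulA : associative prod_mul.
Proof. by move=> x y z; rewrite /prod_mul /= !m0mulA. Qed.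
Fact prod_mulC : commutative prod_mul.
Proof. by move=> x y; rewrite /prod_mul m0mulC [m0mul x.2 _]m0mulC. Qed.
Fact prod_mul1 : left_id (m0one, m0one) prod_mul.
Proof. by move=> [x y]; rewrite /prod_mul /= !m0mul1. Qed.
Fact prod_mul0 : left_zero (m0zero, m0zero) prod_mul.
Proof. by move=> [x y]; rewrite /prod_mul /= !m0mul0. Qed.

Definition prod_monoid0 : monoid0 := Monoid0 prod_mulA prod_mulC prod_mul1 prod_mul0.

(* The pair (c, d) stands for the elementary tensor of c and d. tensor_le is  *)
(* the smallest additive and multiplicative preorder on formal sums of        *)
(* elementary tensors that is compatible with K and with the orders (hence    *)
(* the additions) of C and D; the tensor product is its antisymmetric         *)
(* quotient. See otensor_pushout for the universal property.                  *)
Inductive tensor_le : seq prod_monoid0 -> seq prod_monoid0 -> Prop :=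
| tle_perm s t : perm_eq s t -> tensor_le s t
| tle_trans s t u : tensor_le s t -> tensor_le t u -> tensor_le s u
| tle_cat s t u : tensor_le s t -> tensor_le (s ++ u) (t ++ u)
| tle_mul s t u : tensor_le s t -> tensor_le (fsmul s u) (fsmul t u)
| tle_base a : tensor_le [:: (f a, m0one)] [:: (m0one, g a)]
| tle_base_sym a : tensor_le [:: (m0one, g a)] [:: (f a, m0one)]
| tle_left (s t : seq C) :
    ob_le (\sum_(c <- s) ob_incl c) (\sum_(c <- t) ob_incl c) ->
    tensor_le [seq (c, m0one) | c <- s] [seq (c, m0one) | c <- t]
| tle_right (s t : seq D) :
    ob_le (\sum_(d <- s) ob_incl d) (\sum_(d <- t) ob_incl d) ->
    tensor_le [seq (m0one, d) | d <- s] [seq (m0one, d) | d <- t].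

Local Notation T := (seq prod_monoid0).
Definition tensor_eqv (s t : T) : bool := `[< tensor_le s t /\ tensor_le t s >].
Fact tensor_eqv_refl : reflexive tensor_eqv.
Proof. by move=> s; apply/asboolP; split; exact: tle_perm. Qed.
Fact tensor_eqv_sym : symmetric tensor_eqv.
Proof. by move=> s t; apply/asboolP/asboolP => -[]. Qed.
Fact tensor_eqv_trans : transitive tensor_eqv.
Proof.
move=> t s u /asboolP[st ts] /asboolP[tu ut].
by apply/asboolP; split; [exact: tle_trans tu|exact: tle_trans ts].
Qed.
Fact tensor_eqv_perm (s t : T) : perm_eq s t -> tensor_eqv s t.
Proof.
by move=> st; apply/asboolP; split; apply: tle_perm; rewrite // perm_sym.
Qed.
Fact tensor_eqv_cat (s t u : T) : tensor_eqv s t -> tensor_eqv (s ++ u) (t ++ u).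
Proof. by move=> /asboolP[st ts]; apply/asboolP; split; exact: tle_cat. Qed.
Fact tensor_eqv_mul (s t u : T) : tensor_eqv s t -> tensor_eqv (fsmul s u) (fsmul t u).
Proof. by move=> /asboolP[st ts]; apply/asboolP; split; exact: tle_mul. Qed.

Definition tensor_cong : fscong prod_monoid0 :=
  FSCong tensor_eqv_refl tensor_eqv_sym tensor_eqv_trans
    tensor_eqv_perm tensor_eqv_cat tensor_eqv_mul.

Definition tensor_plus : comPzSemiRingType := fsquot tensor_cong.

Local Notation cls := (fsclass tensor_cong).

Definition tensor_plus_le (x y : tensor_plus) : Prop :=
  tensor_le (fsrepr x) (fsrepr y).

Fact tensor_plus_leE s t : tensor_plus_le (cls s) (cls t) <-> tensor_le s t.
Proof.
have /asboolP[s1 s2] : tensor_eqv (fsrepr (cls s)) s := fsclassK tensor_cong s.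
have /asboolP[t1 t2] : tensor_eqv (fsrepr (cls t)) t := fsclassK tensor_cong t.
split=> st; first exact: tle_trans s2 (tle_trans st t1).
exact: tle_trans s1 (tle_trans st t2).
Qed.

Fact tensor_le_porder : additive_multiplicative_porder tensor_plus_le.
Proof.
split.
- by move=> x; exact: tle_perm.
- move=> x y xy yx; rewrite -[x]fsreprK -[y]fsreprK.
  by apply/fsclassP/asboolP.
- by move=> x y z; exact: tle_trans.
- move=> x y z; rewrite -[x]fsreprK -[y]fsreprK -[z]fsreprK -!fsclassD.
  by move=> /tensor_plus_leE xy; apply/tensor_plus_leE; exact: tle_cat.
- move=> x y z; rewrite -[x]fsreprK -[y]fsreprK -[z]fsreprK -!fsclassM.
  by move=> /tensor_plus_leE xy; apply/tensor_plus_leE; exact: tle_mul.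
Qed.

Definition tensor_pure (x : C * D) : tensor_plus := cls [:: x].

Fact tensor_pure_l0 : tensor_pure (m0zero, m0one) = 0.
Proof.
have /tensor_plus_leE h1 : tensor_plus_le (tensor_pure (m0zero, m0one)) 0.
  rewrite -fsclass0; apply/tensor_plus_leE; apply: (@tle_left [:: m0zero] [::]).
  have [re _ _ _ _] := ob_le_porder C.
  by rewrite big_seq1 big_nil ob_incl0; exact: re.
have /tensor_plus_leE h2 : tensor_plus_le 0 (tensor_pure (m0zero, m0one)).
  rewrite -fsclass0; apply/tensor_plus_leE; apply: (@tle_left [::] [:: m0zero]).
  have [re _ _ _ _] := ob_le_porder C.
  by rewrite big_seq1 big_nil ob_incl0; exact: re.
by have [_ an _ _ _] := tensor_le_porder; apply: an; apply/tensor_plus_leE.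
Qed.

Fact tensor_pureM x y : tensor_pure (prod_mul x y) = tensor_pure x * tensor_pure y.
Proof. by rewrite /tensor_pure -fsclassM. Qed.

Definition tensor_range := range tensor_pure.
Fact tensor_range0 : tensor_range 0.
Proof. by exists (m0zero, m0one) => //; exact: tensor_pure_l0. Qed.
Fact tensor_range1 : tensor_range 1. Proof. by exists (m0one, m0one). Qed.
Fact tensor_rangeM x y : tensor_range x -> tensor_range y -> tensor_range (x * y).
Proof. by move=> [a _ <-] [b _ <-]; exists (prod_mul a b); rewrite ?tensor_pureM. Qed.

Definition tensor_bullet : monoid0 := sub_monoid0 tensor_range0 tensor_range1 tensor_rangeM.

Definition tensor_incl (x : tensor_bullet) : tensor_plus := val x.
Fact tensor_incl_inj : injective tensor_incl. Proof. exact: val_inj. Qed.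
Fact tensor_incl_gen (H : set tensor_plus) : H 0 -> H 1 ->
  (forall x y, H x -> H y -> H (x + y)) ->
  (forall x y, H x -> H y -> H (x * y)) ->
  (forall b, H (tensor_incl b)) -> forall x, H x.
Proof.
move=> H0 _ HD _ HR x; rewrite -[x]fsreprK fsclassE.
elim/big_ind: _ => // a _.
have Ra : tensor_range (tensor_pure a) by exists a.
pose b : tensor_bullet := (exist _ (tensor_pure a) (mem_set Ra) : tensor_range).
exact: (HR b).
Qed.

Definition otensor : oblpr :=
  @OBlpr tensor_bullet tensor_plus tensor_incl tensor_incl_inj erefl erefl (fun _ _ => erefl)
    tensor_incl_gen tensor_plus_le tensor_le_porder.

Fact tensor_range_pure x : tensor_pure x \in tensor_range. Proof. by apply: mem_set; exists x. Qed.

Definition tens (c : C) (d : D) : otensor :=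
  (exist _ (tensor_pure (c, d)) (tensor_range_pure (c, d)) : tensor_bullet).

Fact tens_inl0 : tens m0zero m0one = m0zero.
Proof. by apply: val_inj; rewrite /= tensor_pure_l0. Qed.

Fact tensor_pure_r0 : tensor_pure (m0one, m0zero) = 0.
Proof.
rewrite -tensor_pure_l0; apply/fsclassP/asboolP.
rewrite -(oh0 f) -(oh0 g); split; [exact: tle_base_sym|exact: tle_base].
Qed.

Fact tens_inr0 : tens m0one m0zero = m0zero.
Proof. by apply: val_inj; rewrite /= tensor_pure_r0. Qed.

Lemma tensM c d c' d' : tens (m0mul c c') (m0mul d d') =
  m0mul (tens c d) (tens c' d').
Proof. by apply: val_inj; exact: (tensor_pureM (c, d) (c', d')). Qed.

Lemma tensE (x : otensor) : exists c d, x = tens c d.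
Proof.
have [[c d] _ cdx] : tensor_range (val x) := set_valP x.
by exists c, d; apply: val_inj; rewrite /= -cdx.
Qed.

Lemma tens_base a : tens (f a) m0one = tens m0one (g a).
Proof.
apply: val_inj; apply/fsclassP/asboolP.
by split; [exact: tle_base|exact: tle_base_sym].
Qed.

Section Inclusion.
Variables (B : oblpr) (i : B -> prod_monoid0).
Hypothesis i1 : i m0one = m0one.
Hypothesis iM : {morph i : x y / m0mul x y >-> m0mul x y}.
Hypothesis ile : forall s t : seq B,
  ob_le (\sum_(c <- s) ob_incl c) (\sum_(c <- t) ob_incl c) ->
  tensor_le [seq i c | c <- s] [seq i c | c <- t].

Definition ob_dec (x : ob_plus B) : seq B := sval (cid (ob_sum x)).
Definition ob_decE x : x = \sum_(c <- ob_dec x) ob_incl c := svalP (cid (ob_sum x)).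
Definition tensor_ext (x : ob_plus B) : tensor_plus := cls [seq i c | c <- ob_dec x].

Fact tensor_extE s : tensor_ext (\sum_(c <- s) ob_incl c) = cls [seq i c | c <- s].
Proof.
have [re _ _ _ _] := ob_le_porder B.
by apply/fsclassP/asboolP; split; apply: ile; rewrite -ob_decE; exact: re.
Qed.

Fact tensor_ext_add : nmod_morphism tensor_ext.
Proof.
split.
  rewrite [X in tensor_ext X](_ : 0 = \sum_(c <- [::]) @ob_incl B c) ?tensor_extE //.
  by rewrite big_nil.
move=> x y; rewrite [x]ob_decE [y]ob_decE -big_cat !tensor_extE -fsclassD.
by rewrite map_cat.
Qed.

Fact tensor_ext_mul : monoid_morphism tensor_ext.
Proof.
split.
  rewrite [X in tensor_ext X](_ : 1 = \sum_(c <- [:: m0one]) @ob_incl B c).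
    by rewrite tensor_extE /= i1.
  by rewrite big_seq1 ob_incl1.
move=> x y; rewrite [x]ob_decE [y]ob_decE.
have -> : (\sum_(c <- ob_dec x) ob_incl c) * (\sum_(c <- ob_dec y) ob_incl c) =
    \sum_(c <- fsmul (ob_dec x) (ob_dec y)) @ob_incl B c.
  rewrite /fsmul big_flatten /= big_map mulr_suml; apply: eq_bigr => a _.
  by rewrite big_map mulr_sumr; apply: eq_bigr => b _; rewrite ob_inclM.
rewrite !tensor_extE -fsclassM; congr fsclass.
rewrite /fsmul map_allpairs allpairs_mapl allpairs_mapr.
by apply: eq_allpairs => a b; exact: iM.
Qed.

HB.instance Definition _ := GRing.isNmodMorphism.Build _ _ tensor_ext tensor_ext_add.
HB.instance Definition _ := GRing.isMonoidMorphism.Build _ _ tensor_ext tensor_ext_mul.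

Lemma tensor_incl_ext : exists h : {rmorphism ob_plus B -> ob_plus otensor},
  (forall b, h (ob_incl b) = tensor_pure (i b)) /\
  (forall x y, ob_le x y -> ob_le (h x) (h y)).
Proof.
exists tensor_ext; split=> [b|x y].
  by have := tensor_extE [:: b]; rewrite big_seq1.
by rewrite [x]ob_decE [y]ob_decE => xy; rewrite /= !tensor_extE; apply/tensor_plus_leE; exact: ile.
Qed.

End Inclusion.

Lemma tens11 : tens m0one m0one = m0one.
Proof. exact: val_inj. Qed.
Fact tens_inlM : {morph tens^~ m0one : x y / m0mul x y >-> m0mul x y}.
Proof. by move=> x y; rewrite -tensM m0mul1. Qed.
Fact tens_inrM : {morph tens m0one : x y / m0mul x y >-> m0mul x y}.
Proof. by move=> x y; rewrite -tensM m0mul1. Qed.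

Fact tens_inl_ext : exists h : {rmorphism ob_plus C -> ob_plus otensor},
  (forall b, h (ob_incl b) = ob_incl (tens b m0one)) /\
  (forall x y, ob_le x y -> ob_le (h x) (h y)).
Proof.
apply: (@tensor_incl_ext C (fun c => (c, m0one))) => //; last exact: tle_left.
by move=> x y; rewrite /= /prod_mul m0mul1.
Qed.
Fact tens_inr_ext : exists h : {rmorphism ob_plus D -> ob_plus otensor},
  (forall b, h (ob_incl b) = ob_incl (tens m0one b)) /\
  (forall x y, ob_le x y -> ob_le (h x) (h y)).
Proof.
apply: (@tensor_incl_ext D (fun d => (m0one, d))) => //; last exact: tle_right.
by move=> x y; rewrite /= /prod_mul m0mul1.
Qed.

Definition tens_inl : ohom C otensor := 
  @OHom C otensor (tens^~ m0one) tens_inl0 tens11 tens_inlM tens_inl_ext.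
Definition tens_inr : ohom D otensor := 
  @OHom D otensor (tens m0one) tens_inr0 tens11 tens_inrM tens_inr_ext.

Section Universal.
Variables (E : oblpr) (p : ohom C E) (q : ohom D E).
Hypothesis pq : forall a, p (f a) = q (g a).

Definition tens_fun (x : prod_monoid0) : ob_plus E := ob_incl (m0mul (p x.1) (q x.2)).
Fact tens_fun1 : tens_fun m0one = 1. Proof. by rewrite /tens_fun /= !oh1 m0mul1 ob_incl1. Qed.
Fact tens_funM : {morph tens_fun : x y / m0mul x y >-> x * y}.
Proof.
move=> x y; rewrite /tens_fun /= !ohM -ob_inclM; congr ob_incl.
by rewrite -!m0mulA; congr m0mul; rewrite !m0mulA; congr m0mul; rewrite m0mulC.
Qed.

Definition tens_sum (s : T) := \sum_(x <- s) tens_fun x.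
Fact tens_sumM s t : tens_sum (fsmul s t) = tens_sum s * tens_sum t.
Proof.
rewrite /tens_sum /fsmul big_flatten /= big_map mulr_suml; apply: eq_bigr => x _.
by rewrite big_map mulr_sumr; apply: eq_bigr => y _; rewrite tens_funM.
Qed.

Fact tens_sum_le s t : tensor_le s t -> ob_le (tens_sum s) (tens_sum t).
Proof.
have [re an tr ad mu] := ob_le_porder E.
elim=> {s t} [s t st|s t u _ st _ tu|s t u _ st|s t u _ st|a|a|s t st|s t st].
- by rewrite /tens_sum (perm_big _ st); exact: re.
- exact: tr tu.
- by rewrite /tens_sum !big_cat; exact: ad.
- by rewrite !tens_sumM; exact: mu.
- by rewrite /tens_sum !big_seq1 /tens_fun /= !oh1 m0mul1 m0mulC m0mul1 pq; exact: re.
- by rewrite /tens_sum !big_seq1 /tens_fun /= !oh1 m0mul1 m0mulC m0mul1 pq; exact: re.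
- have [h [hE hle]] := oh_ext p; have := hle _ _ st; rewrite !rmorph_sum /=.
  rewrite /tens_sum !big_map /tens_fun /=.
  by under eq_bigr do rewrite hE; under [X in ob_le _ X]eq_bigr do rewrite hE;
     under [X in _ -> ob_le X _]eq_bigr do rewrite oh1 m0mulC m0mul1;
     under [X in _ -> ob_le _ X]eq_bigr do rewrite oh1 m0mulC m0mul1.
- have [h [hE hle]] := oh_ext q; have := hle _ _ st; rewrite !rmorph_sum /=.
  rewrite /tens_sum !big_map /tens_fun /=.
  by under eq_bigr do rewrite hE; under [X in ob_le _ X]eq_bigr do rewrite hE;
     under [X in _ -> ob_le X _]eq_bigr do rewrite oh1 m0mul1;
     under [X in _ -> ob_le _ X]eq_bigr do rewrite oh1 m0mul1.
Qed.

Fact tens_sum_compat s t : tensor_cong s t -> \sum_(x <- s) tens_fun x = \sum_(x <- t) tens_fun x.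
Proof.
move=> /asboolP[st ts]; have [_ an _ _ _] := ob_le_porder E.
by apply: an; exact: tens_sum_le.
Qed.

Definition tens_lift : {rmorphism tensor_plus -> ob_plus E} := fslift (FSMor tens_fun1 tens_funM tens_sum_compat).
Fact tens_liftE s : tens_lift (cls s) = tens_sum s. Proof. exact: fsliftE. Qed.

Fact tens_dec (x : otensor) : {cd : C * D | val x = tensor_pure cd}.
Proof.
by apply: cid; have [cd _ cdx] : tensor_range (val x) := set_valP x; exists cd.
Qed.

Definition tens_rec_fun (x : otensor) : E := m0mul (p (sval (tens_dec x)).1) (q (sval (tens_dec x)).2).

Fact tens_rec_funE x : ob_incl (tens_rec_fun x) = tens_lift (val x).
Proof. by rewrite (svalP (tens_dec x)) tens_liftE /tens_sum big_seq1. Qed.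

Fact tens_rec_fun_tens c d : tens_rec_fun (tens c d) = m0mul (p c) (q d).
Proof. by apply: ob_incl_inj; rewrite tens_rec_funE tens_liftE /tens_sum big_seq1. Qed.

Fact tens_rec0 : tens_rec_fun m0zero = m0zero.
Proof. by apply: ob_incl_inj; rewrite tens_rec_funE ob_incl0 [val _]/= rmorph0. Qed.
Fact tens_rec1 : tens_rec_fun m0one = m0one.
Proof. by apply: ob_incl_inj; rewrite tens_rec_funE ob_incl1 [val _]/= rmorph1. Qed.
Fact tens_recM : {morph tens_rec_fun : x y / m0mul x y >-> m0mul x y}.
Proof.
by move=> x y; apply: ob_incl_inj; rewrite ob_inclM !tens_rec_funE [val _]/= rmorphM.
Qed.
Fact tens_rec_ext : exists h : {rmorphism ob_plus otensor -> ob_plus E},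
  (forall b, h (ob_incl b) = ob_incl (tens_rec_fun b)) /\
  (forall x y, ob_le x y -> ob_le (h x) (h y)).
Proof.
exists tens_lift; split=> [b|x y]; first by rewrite tens_rec_funE.
by rewrite -[x]fsreprK -[y]fsreprK => /tensor_plus_leE xy; rewrite !tens_liftE; exact: tens_sum_le.
Qed.

Definition tens_rec : ohom otensor E := OHom tens_rec0 tens_rec1 tens_recM tens_rec_ext.

Lemma tens_recE c d : tens_rec (tens c d) = m0mul (p c) (q d).
Proof. exact: tens_rec_fun_tens. Qed.

End Universal.

End Tensor.

Definition is_pushout (K C D P : oblpr) (f : ohom K C) (g : ohom K D)
    (i : ohom C P) (j : ohom D P) : Prop :=
  (forall a, i (f a) = j (g a)) /\
  forall (E : oblpr) (p : ohom C E) (q : ohom D E),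
    (forall a, p (f a) = q (g a)) ->
    exists! h : ohom P E, (forall c, h (i c) = p c) /\ (forall d, h (j d) = q d).

Lemma otensor_pushout (K C D : oblpr) (f : ohom K C) (g : ohom K D) :
  is_pushout f g (tens_inl f g) (tens_inr f g).
Proof.
split=> [a|E p q pq]; first exact: tens_base.
exists (tens_rec pq); split.
  split=> [c|d]; rewrite /= -[LHS]/(tens_rec pq _) tens_recE oh1.
    by rewrite m0mulC m0mul1.
  by rewrite m0mul1.
move=> h [hp hq]; apply: ohomP => x; have [c [d ->]] := tensE x.
rewrite tens_recE -hp -hq -ohM; congr (h _).
rewrite -[LHS]/(m0mul (tens f g c m0one) (tens f g m0one d)) -tensM m0mul1.
by rewrite m0mulC m0mul1.
Qed.

Section BaseChange.
Variables (K T : oblpr) (v : ohom K T).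

Definition base_change (B : oalg K) : oalg T :=
  OAlg (tens_inr (oa_str B) v).

Variables (B C : oalg K) (phi : ohomK B C).

Fact base_change_compat a : ocomp (tens_inl (oa_str C) v) phi (oa_str B a) =
  tens_inr (oa_str C) v (v a).
Proof.
rewrite -[LHS]/(tens_inl (oa_str C) v (phi (oa_str B a))) ohk_lin.
exact: tens_base.
Qed.

Definition base_change_hom : ohom (base_change B) (base_change C) := tens_rec base_change_compat.

Fact base_change_hom_lin t : base_change_hom (oa_str (base_change B) t) = oa_str (base_change C) t.
Proof.
by rewrite [LHS]tens_recE oh1 m0mul1.
Qed.

Definition base_change_map : ohomK (base_change B) (base_change C) :=
  @OHomK T (base_change B) (base_change C) base_change_hom base_change_hom_lin.

Lemma base_change_mapE (b : B) (t : T) :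
  base_change_map (tens (oa_str B) v b t) = tens (oa_str C) v (phi b) t.
Proof.
rewrite [LHS]tens_recE /= -[LHS]/(m0mul (tens _ _ _ _) (tens _ _ _ _)) -tensM.
by rewrite m0mul1 m0mulC m0mul1.
Qed.

End BaseChange.

Section RingMon.
Variable S : comPzRingType.

Definition ring_monoid0 : monoid0 :=
  @Monoid0 S *%R 1 0 (@mulrA S) (@mulrC S) (@mul1r S) (@mul0r S).

Definition mon_rel (x y : m0plus ring_monoid0) : Prop :=
  exists a b c : S, [/\ c = a + b, x = @m0single ring_monoid0 c
    & y = @m0single ring_monoid0 a + @m0single ring_monoid0 b].

Lemma mon_rel_expanding : expanding mon_rel.
Proof.
split=> [_ _ d [a [b [c [-> -> ->]]]]|_ _ [a [b [c [-> -> ->]]]]].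
  exists (a * d), (b * d), (a * d + b * d); split=> //.
    by rewrite -m0singleM /= mulrDl.
  by rewrite mulrDl -!m0singleM.
have [->|a0] := eqVneq a 0; first by left; rewrite m0single0 !add0r.
have [->|b0] := eqVneq b 0; first by left; rewrite m0single0 !addr0.
by right; rewrite m0lenD !m0len_single a0 b0 /=; case: (_ != _).
Qed.

Definition mon : oblpr := free_oblpr mon_rel_expanding.

End RingMon.

Section MonMap.
Variables (S S' : comPzRingType) (f : {rmorphism S -> S'}).

Fact mon_map0 : f 0 = 0. Proof. exact: rmorph0. Qed.
Fact mon_map1 : f 1 = 1. Proof. exact: rmorph1. Qed.
Fact mon_mapM : {morph f : x y / x * y}. Proof. exact: rmorphM. Qed.
Fact mon_map_rel x y : @mon_rel S x y -> exists s t : seq S,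
  [/\ x = \sum_(a <- s) @m0single (ring_monoid0 S) a,
      y = \sum_(a <- t) @m0single (ring_monoid0 S) a
    & @ob_le (mon S') (\sum_(a <- s) @ob_incl (mon S') (f a))
                      (\sum_(a <- t) @ob_incl (mon S') (f a))].
Proof.
move=> [a [b [c [-> -> ->]]]]; exists [:: a + b], [:: a; b].
rewrite !big_cons !big_nil !addr0; split=> //; apply: generated_order_base.
by exists (f a), (f b), (f (a + b)); rewrite rmorphD.
Qed.

Definition mon_map : ohom (mon S) (mon S') :=
  @free_ohom (ring_monoid0 S) _ (mon_rel_expanding S) (mon S') f mon_map0 mon_map1 mon_mapM mon_map_rel.

End MonMap.

Lemma mon_sum (S : comPzRingType) (s : seq S) :
  @ob_le (mon S) (@m0single (ring_monoid0 S) (\sum_(a <- s) a))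
    (\sum_(a <- s) @m0single (ring_monoid0 S) a).
Proof.
have [re _ tr ad _] := ob_le_porder (mon S).
elim: s => [|a s IHs].
  by rewrite !big_nil -[X in ob_le _ X]m0single0; exact: re.
rewrite !big_cons.
apply: (tr _ (@m0single (ring_monoid0 S) a +
              @m0single (ring_monoid0 S) (\sum_(b <- s) b))).
  by apply: generated_order_base; exists a, (\sum_(b <- s) b), (a + \sum_(b <- s) b).
by rewrite addrC [X in ob_le _ X]addrC; exact: ad.
Qed.

Section Tropical.
Variable R : realType.
Implicit Types a b c : {nonneg R}.

Definition nn_mul a b : {nonneg R} := (a%:num * b%:num)%:nng.

Fact nn_mulA : associative nn_mul.
Proof. by move=> a b c; apply: val_inj; rewrite /= mulrA. Qed.
Fact nn_mulC : commutative nn_mul.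
Proof. by move=> a b; apply: val_inj; rewrite /= mulrC. Qed.
Fact nn_mul1 : left_id 1%:nng nn_mul.
Proof. by move=> a; apply: val_inj; rewrite /= mul1r. Qed.
Fact nn_mul0 : left_zero 0%:nng nn_mul.
Proof. by move=> a; apply: val_inj; rewrite /= mul0r. Qed.

Definition nn_monoid0 : monoid0 := Monoid0 nn_mulA nn_mulC nn_mul1 nn_mul0.

Definition max_twice3 a b c : Prop :=
  [\/ a = b /\ c%:num <= a%:num, a = c /\ b%:num <= a%:num
    | b = c /\ a%:num <= b%:num].

Definition trop_rel (x y : m0plus nn_monoid0) : Prop :=
  exists a b c, [/\ max_twice3 a b c, x = @m0single nn_monoid0 c
    & y = @m0single nn_monoid0 a + @m0single nn_monoid0 b].

Fact nn_le_eq0 a b : b%:num <= a%:num -> a = 0%:nng -> b = 0%:nng.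
Proof.
move=> + a0; rewrite {}a0 /= => b0; apply: val_inj => /=.
by apply/eqP; rewrite eq_le b0 /=.
Qed.

Lemma trop_rel_expanding : expanding trop_rel.
Proof.
split=> [_ _ d [a [b [c [m -> ->]]]]|_ _ [a [b [c [m -> ->]]]]].
  exists (nn_mul a d), (nn_mul b d), (nn_mul c d); split.
  - by case: m => -[-> le];
      [apply: Or31|apply: Or32|apply: Or33]; split=> //=; exact: ler_wpM2r.
  - by rewrite -m0singleM.
  - by rewrite mulrDl -!m0singleM.
have [a0|a0] := eqVneq a 0%:nng.
  left; suff -> : c = b by rewrite a0 -[0%:nng]/(@m0zero nn_monoid0) m0single0 add0r.
  case: m => -[ab le]; last by [].
    by rewrite -ab a0; exact: nn_le_eq0 le a0.
  by rewrite -ab a0; apply/esym; exact: nn_le_eq0 le a0.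
have [b0|b0] := eqVneq b 0%:nng.
  left; suff -> : c = a by rewrite b0 -[0%:nng]/(@m0zero nn_monoid0) m0single0 addr0.
  case: m => -[ab le]; last by rewrite -ab b0; apply/esym; exact: nn_le_eq0 le b0.
    by rewrite ab b0; apply: nn_le_eq0 b0; rewrite -ab.
  by [].
by right; rewrite m0lenD !m0len_single a0 b0 /=; case: (_ != _).
Qed.

Definition tropical : oblpr := free_oblpr trop_rel_expanding.

End Tropical.

Record naseminorm (R : realType) (S : comPzRingType) := NASeminorm {
  sn :> S -> {nonneg R};
  sn0 : sn 0 = 0%:nng;
  sn1 : sn 1 = 1%:nng;
  snM : forall a b, sn (a * b) = nn_mul (sn a) (sn b);
  snD : forall a b, (sn (a + b))%:num <= Num.max (sn a)%:num (sn b)%:num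
}.

Section Seminorm.
Variables (R : realType) (S : comPzRingType) (w : naseminorm R S).

Lemma snN a : w (- a) = w a.
Proof.
have wN1 : (w (-1))%:num = 1 :> R.
  have : (w (-1))%:num ^+ 2 = 1 :> R.
    by rewrite expr2; have := snM w (-1) (-1); rewrite mulrNN mulr1 sn1 => /(congr1 num) /= <-.
  by move=> /eqP; rewrite sqrp_eq1 // => /eqP.
by rewrite -mulN1r snM; apply: val_inj; rewrite /= wN1 mul1r.
Qed.

Lemma sn_max_twice a b : max_twice3 (w a) (w b) (w (a + b)).
Proof.
have dom x y : (w x)%:num < (w y)%:num -> w y = w (x + y).
  move=> xy; apply: val_inj => /=; apply/eqP; rewrite eq_le; apply/andP; split.
    have := snD w (x + y) (- x); rewrite addrAC subrr add0r snN.
    by rewrite le_max => /orP[//|]; rewrite leNgt xy.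
  by apply: le_trans (snD w x y) _; rewrite ge_max lexx ltW.
case: (ltgtP (w a)%:num (w b)%:num) => ab.
- by apply: Or33; split; [exact: dom|exact: ltW].
- by apply: Or32; split; [rewrite addrC; exact: dom|exact: ltW].
- apply: Or31; split; first exact: val_inj.
  by apply: le_trans (snD w a b) _; rewrite ab maxxx.
Qed.

Fact seminorm_hom_rel x y : @mon_rel S x y -> exists s t : seq S,
  [/\ x = \sum_(a <- s) @m0single (ring_monoid0 S) a,
      y = \sum_(a <- t) @m0single (ring_monoid0 S) a
    & @ob_le (tropical R) (\sum_(a <- s) @ob_incl (tropical R) (w a))
                          (\sum_(a <- t) @ob_incl (tropical R) (w a))].
Proof.
move=> [a [b [c [-> -> ->]]]]; exists [:: a + b], [:: a; b].
rewrite !big_cons !big_nil !addr0; split=> //; apply: generated_order_base.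
by exists (w a), (w b), (w (a + b)); split=> //; exact: sn_max_twice.
Qed.

Definition seminorm_hom : ohom (mon S) (tropical R) :=
  @free_ohom (ring_monoid0 S) _ (mon_rel_expanding S) (tropical R) w
    (sn0 w) (sn1 w) (snM w) seminorm_hom_rel.

Lemma sn_sum_lt (I : Type) (s : seq I) (P : pred I) (F : I -> S) (M : R) : 0 < M ->
  (forall i, P i -> (w (F i))%:num < M) -> (w (\sum_(i <- s | P i) F i))%:num < M.
Proof.
move=> M0 FM; elim/big_ind: _ => //; first by rewrite sn0.
by move=> x y xM yM; apply: le_lt_trans (snD w x y) _; rewrite gt_max xM.
Qed.

End Seminorm.

Definition homeomorphism (X Y : topologicalType) (h : X -> Y) : Prop :=
  continuous h /\ exists g : Y -> X, [/\ cancel h g, cancel g h & continuous g].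

HB.instance Definition _ (R : realType) :=
  Topological.copy {nonneg R} (initial_topology (fun x : {nonneg R} => x%:num)).

(* The coarsest topology on X such that all ev i : X -> Y are continuous. *)
Definition eval_topology (X : choiceType) (I : Type) (Y : topologicalType)
    (ev : I -> X -> Y) : topologicalType :=
  sup_topology (fun i => Topological.class (initial_topology (ev i))).

Definition tpoints (R : realType) (C : oalg (tropical R)) : Type :=
  ohomK C (oalg_self (tropical R)).

Section TPoints.
Variable R : realType.

HB.instance Definition _ (C : oalg (tropical R)) := gen_eqMixin (tpoints C).
HB.instance Definition _ (C : oalg (tropical R)) := gen_choiceMixin (tpoints C).

Definition tpoint_eval (C : oalg (tropical R)) (b : C) (f : tpoints C) :
  {nonneg R} := ohk_hom f b.

HB.instance Definition _ (C : oalg (tropical R)) :=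
  Topological.copy (tpoints C) (eval_topology (@tpoint_eval C)).

Definition tpoints_comp (C D : oalg (tropical R)) (g : ohomK C D)
  (x : tpoints D) : tpoints C := ocompK x g.

End TPoints.

Record analytification (R : realType) (k : fieldType) (v : naseminorm R k)
    (S : comPzRingType) (kS : {rmorphism k -> S}) := Analytification {
  an_norm :> naseminorm R S;
  an_extends : forall c, an_norm (kS c) = v c
}.

Section Analytification.
Variables (R : realType) (k : fieldType) (v : naseminorm R k).
Variables (S : comPzRingType) (kS : {rmorphism k -> S}).
Local Notation Xan := (analytification v kS).

HB.instance Definition _ := gen_eqMixin Xan.
HB.instance Definition _ := gen_choiceMixin Xan.
HB.instance Definition _ :=
  Topological.copy Xan (eval_topology (fun (a : S) (w : Xan) => w a)).

End Analytification.

Record character (R : realType) (A : monoidType) := Character {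
  ch_fun :> A -> {nonneg R};
  ch1 : ch_fun 1%g = 1%:nng;
  chM : forall a b, ch_fun (a * b)%g = nn_mul (ch_fun a) (ch_fun b)
}.

Section Character.
Variables (R : realType) (A : monoidType).

HB.instance Definition _ := gen_eqMixin (character R A).
HB.instance Definition _ := gen_choiceMixin (character R A).
HB.instance Definition _ := Topological.copy (character R A)
  (eval_topology (fun (a : A) (f : character R A) => f a)).

(* If all terms vanish, the maximum 0 is considered to occur twice; this is   *)
(* automatic unless A is trivial.                                             *)
Definition trop_zeros (p : A -> {nonneg R}) : set (character R A) :=
  [set f | (exists a b, [/\ a <> b, nn_mul (p a) (f a) = nn_mul (p b) (f b)
              & forall c, (nn_mul (p c) (f c))%:num <= (nn_mul (p a) (f a))%:num])
           \/ forall a, nn_mul (p a) (f a) = 0%:nng].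

End Character.

(* The universally quantified H expresses that x lies in the subgroup of G    *)
(* generated by the image of A.                                               *)
Definition toric_monoid (A : monoidType) : Prop :=
  [/\ forall a b : A, (a * b)%g = (b * a)%g,
      exists s : seq A, forall a : A,
        exists2 t : seq A, {subset t <= s} & a = (\prod_(b <- t) b)%g
    & exists (G : groupType) (j : A -> G),
      [/\ forall x y : G, (x * y)%g = (y * x)%g,
          j 1%g = 1%g, {morph j : a b / (a * b)%g}, injective j
        & forall (x : G) (n : nat),
            (forall H : set G, H 1%g -> (forall y z, H y -> H z -> H (y * z)%g) ->
               (forall y, H y -> H (y^-1)%g) -> (forall a, H (j a)) -> H x) ->
            (0 < n)%N -> (exists a, j a = (x ^+ n)%g) -> exists a, j a = x]].

Record toric_immersion (k : fieldType) (S : comPzRingType)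
    (kS : {rmorphism k -> S}) (A : monoidType) := ToricImmersion {
  ti_map :> {rmorphism monalg k A -> S};
  ti_linear : forall c, ti_map (monom c 1%g) = kS c;
  ti_surj : forall r, exists p, ti_map p = r
}.

Section Tropicalization.
Variables (R : realType) (k : fieldType) (v : naseminorm R k).
Variables (S : comPzRingType) (kS : {rmorphism k -> S}).
Variables (A : monoidType) (iota : toric_immersion kS A).

Lemma ti_monom c a : iota (monom c a) = kS c * iota (monom 1 a).
Proof. by rewrite -(ti_linear iota) -rmorphM monomM mulr1 mul1g. Qed.

Definition tropicalization : set (character R A) :=
  \bigcap_(p in [set p | iota p = 0]) trop_zeros (fun a => v (macoef p a)).

Section TropMap.
Variable w : analytification v kS.

Fact trop_fun1 : w (iota (monom 1 1%g)) = 1%:nng.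
Proof. by rewrite monom1E rmorph1 sn1. Qed.
Fact trop_funM a b : w (iota (monom 1 (a * b)%g)) =
  nn_mul (w (iota (monom 1 a))) (w (iota (monom 1 b))).
Proof. by rewrite -snM -rmorphM monomM mulr1. Qed.

Definition trop_char : character R A := Character trop_fun1 trop_funM.

Fact trop_char_in : trop_char \in tropicalization.
Proof.
apply/mem_set => p /= p0; rewrite /trop_zeros /=.
pose F a := nn_mul (v (macoef p a)) (trop_char a).
have FE a : F a = w (iota (monom (macoef p a) a)).
  by rewrite /F ti_monom snM an_extends.
have Fout a : a \notin masupp p -> F a = 0%:nng.
  by move=> /macoef_out pa; rewrite FE pa monom0 rmorph0 sn0.
have [all0|/existsNP[a0 Fa0]] := pselect (forall a, F a = 0%:nng); first by right.
have Fa0_gt0 : 0 < (F a0)%:num.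
  rewrite lt_neqAle ge0 andbT; apply/eqP => h; apply: Fa0; exact/val_inj/esym.
have a0p : a0 \in masupp p by apply: contraT => /Fout.
have [m mp mmax] : exists2 m, m \in masupp p &
    forall a, a \in masupp p -> (F a)%:num <= (F m)%:num.
  pose m := [arg max_(x > [` a0p]%fset) (F (val x))%:num]%O.
  exists (val m); first exact: valP.
  rewrite /m; case: Order.TotalTheory.arg_maxP => // i _ imax a ap.
  exact: (imax [` ap]%fset).
have Fm_max a : (F a)%:num <= (F m)%:num.
  have [/mmax //|/Fout ->] := boolP (a \in masupp p).
  exact: ge0.
left; apply: contrapT => no2.
have Flt a : a != m -> (F a)%:num < (F m)%:num.
  move=> am; rewrite lt_neqAle Fm_max andbT; apply/eqP => Fam; apply: no2.
  by exists m, a; split=> //; [exact/nesym/eqP|exact/val_inj/esym].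
have Fm_gt0 : 0 < (F m)%:num by exact: lt_le_trans (Fm_max a0).
have : \sum_(a <- masupp p) iota (monom (macoef p a) a) = 0.
  by rewrite -rmorph_sum -monalgE.
rewrite (big_fsetD1 m) //= => /eqP; rewrite addr_eq0 => /eqP /(congr1 w).
rewrite snN -FE => Fm.
suff : (F m)%:num < (F m)%:num by rewrite ltxx.
rewrite {1}Fm big_seq; apply: sn_sum_lt => // a.
by rewrite !inE => /andP[am _]; rewrite -FE; exact: Flt.
Qed.

End TropMap.

Definition trop (w : analytification v kS) : tropicalization :=
  exist _ (trop_char w) (trop_char_in w).

Definition B_set : set S := [set r | exists c a, r = iota (monom c a)].

Fact B_set0 : B_set 0. Proof. by exists 0, 1%g; rewrite monom0 rmorph0. Qed.
Fact B_set1 : B_set 1. Proof. by exists 1, 1%g; rewrite monom1E rmorph1. Qed.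
Fact B_setM x y : B_set x -> B_set y -> B_set (x * y).
Proof.
by move=> [c [a ->]] [d [b ->]]; exists (c * d), (a * b)%g; rewrite -rmorphM monomM.
Qed.

Definition B_bullet : monoid0 := sub_monoid0 B_set0 B_set1 B_setM.
Definition B_val (b : B_bullet) : S := val b.

Definition B_rel (x y : m0plus B_bullet) : Prop :=
  exists (b : B_bullet) (s : seq B_bullet),
    [/\ B_val b = \sum_(d <- s) B_val d, x = m0single b
      & y = \sum_(d <- s) m0single d].

Fact B_rel_expanding : expanding B_rel.
Proof.
split=> [_ _ d [b [s [bs -> ->]]]|_ _ [b [s [bs -> ->]]]].
  exists (m0mul b d), [seq m0mul x d | x <- s]; split.
  - by rewrite big_map -[LHS]/(B_val b * B_val d) bs mulr_suml.
  - by rewrite m0singleM.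
  - by rewrite big_map mulr_suml; apply: eq_bigr => x _; rewrite m0singleM.
have nz (V : nmodType) (G : B_bullet -> V) : G m0zero = 0 ->
    \sum_(d <- s) G d = \sum_(d <- fs_nz s) G d.
  move=> G0; rewrite /fs_nz big_filter [RHS]big_mkcond; apply: eq_bigr => d _.
  by case: eqVneq => [->|].
rewrite nz // in bs; rewrite nz ?m0single0 //.
rewrite -fsclassE m0lenE m0len_single.
have -> : fs_nz (fs_nz s) = fs_nz s by rewrite /fs_nz filter_id.
have : all (fun d => d != m0zero) (fs_nz s) by exact: filter_all.
case: (fs_nz s) bs => [|d [|d' t]] bs.
- move=> _; left; rewrite -[X in _ = X](m0single0 B_bullet); congr m0single.
  by apply: val_inj; move: bs; rewrite big_nil.
- by move=> _; left; congr m0single; apply: val_inj; move: bs; rewrite big_seq1.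
- by move=> _; right; case: (_ != _).
Qed.

Definition B_blueprint : oblpr := free_oblpr B_rel_expanding.

Fact k_to_B_in c : kS c \in B_set.
Proof. by apply/mem_set; exists c, 1%g; rewrite ti_linear. Qed.
Definition k_to_B_fun (c : k) : B_bullet := (exist _ (kS c) (k_to_B_in c) : B_set).
Fact k_to_B0 : k_to_B_fun 0 = m0zero.
Proof. by apply: val_inj; exact: rmorph0. Qed.
Fact k_to_B1 : k_to_B_fun 1 = m0one.
Proof. by apply: val_inj; exact: rmorph1. Qed.
Fact k_to_BM c d : k_to_B_fun (c * d) = m0mul (k_to_B_fun c) (k_to_B_fun d).
Proof. by apply: val_inj; exact: rmorphM. Qed.
Fact k_to_B_rel x y : @mon_rel k x y -> exists s t : seq k,
  [/\ x = \sum_(a <- s) @m0single (ring_monoid0 k) a,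
      y = \sum_(a <- t) @m0single (ring_monoid0 k) a
    & @ob_le B_blueprint (\sum_(a <- s) @ob_incl B_blueprint (k_to_B_fun a))
                         (\sum_(a <- t) @ob_incl B_blueprint (k_to_B_fun a))].
Proof.
move=> [a [b [c [-> -> ->]]]]; exists [:: a + b], [:: a; b].
rewrite !big_cons !big_nil !addr0; split=> //; apply: generated_order_base.
exists (k_to_B_fun (a + b)), [:: k_to_B_fun a; k_to_B_fun b].
rewrite !big_cons !big_nil !addr0; split=> //; exact: rmorphD.
Qed.

Definition B_algebra : oalg (mon k) :=
  OAlg (@free_ohom (ring_monoid0 k) _ (mon_rel_expanding k) B_blueprint
    k_to_B_fun k_to_B0 k_to_B1 k_to_BM k_to_B_rel).

Definition mon_algebra : oalg (mon k) := OAlg (mon_map kS).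

Fact B_val_rel x y : B_rel x y -> exists s t : seq B_bullet,
  [/\ x = \sum_(a <- s) m0single a, y = \sum_(a <- t) m0single a
    & @ob_le (mon S) (\sum_(a <- s) @ob_incl (mon S) (B_val a))
                     (\sum_(a <- t) @ob_incl (mon S) (B_val a))].
Proof.
move=> [b [s [bs -> ->]]]; exists [:: b], s; rewrite !big_seq1; split=> //.
by have := mon_sum [seq B_val d | d <- s]; rewrite !big_map -bs.
Qed.

Definition B_incl_hom : ohom B_blueprint (mon S) :=
  @free_ohom B_bullet _ B_rel_expanding (mon S) B_val erefl erefl
    (fun _ _ => erefl) B_val_rel.

Definition B_incl : ohomK B_algebra mon_algebra :=
  @OHomK (mon k) B_algebra mon_algebra B_incl_hom (fun _ => erefl).

Fact B_elt_in c a : iota (monom c a) \in B_set.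
Proof. by apply/mem_set; exists c, a. Qed.
Definition B_elt (c : k) (a : A) : B_algebra :=
  (exist _ (iota (monom c a)) (B_elt_in c a) : B_set).

End Tropicalization.

Definition Trop (R : realType) (k : fieldType) (v : naseminorm R k)
  (B : oalg (mon k)) : oalg (tropical R) := base_change (seminorm_hom v) B.

Definition Trop_tens (R : realType) (k : fieldType) (v : naseminorm R k)
  (B : oalg (mon k)) (b : B) (t : {nonneg R}) : Trop v B :=
  tens (oa_str B) (seminorm_hom v) b t.
Arguments Trop_tens {R k} v {B} b t.

Definition beta_star (R : realType) (k : fieldType) (v : naseminorm R k)
    (S : comPzRingType) (kS : {rmorphism k -> S}) (A : monoidType)
    (iota : toric_immersion kS A)
    (x : tpoints (Trop v (mon_algebra kS))) : tpoints (Trop v (B_algebra iota)) :=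
  tpoints_comp (base_change_map (seminorm_hom v) (B_incl iota)) x.
Arguments beta_star {R k} v {S kS A} iota x.

(* Main.v *)
Require Import Defs.
From HB Require Import structures.
From mathcomp Require Import all_boot all_order all_algebra finmap.
From mathcomp Require Import generic_quotient interval_inference.
From mathcomp Require Import all_classical all_reals all_analysis.

Set Implicit Arguments.
Unset Strict Implicit.
Unset Printing Implicit Defensive.

Import Order.TTheory GRing.Theory Num.Theory.
Import numFieldNormedType.Exports.

Local Open Scope classical_set_scope.
Local Open Scope ring_scope.

(* By the universal property of the tensor product, a T-point of Trop v B is   *)
(* a morphism from B to the tropical hyperfield that restricts to v on k, and  *)
(* its topology is that of evaluation at the elements of B. Relations in the   *)
(* tropical hyperfield are controlled by maxima: c <= sum s forces c to be at  *)
(* most the maximum of s, and it holds as soon as the maximum of c :: s occurs *)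
(* twice. The first fact turns a T-point of R^mon into a nonarchimedean        *)
(* seminorm; for B, solving a relation p in I for a term of maximal value, it  *)
(* shows that this value is attained by a second term. Conversely, for f in    *)
(* X^trop, a monomial relation in R never has a strictly dominant term, so     *)
(* iota (c a) |-> v c * f a is well defined and preserves the order of B.      *)

(** Both homeomorphisms come from one dictionary. A T-point x of [Trop v B] satisfies x(b tensor t)
    = x(b tensor 1) t ([tpoint_evalE]), so it amounts to a morphism from B to T restricting to v on
    k ([tpointP], [tpoint_of]). For R^mon these morphisms are the seminorms extending v:
    [sn_max_twice] turns sums into tropical relations, and [tropical_le_bound] recovers the
    ultrametric inequality. For the blueprint of iota they are the maps iota(c a) |-> v(c) f(a).
    That f lies in X^trop when it comes from a T-point ([tpoint_char_in]), and that each f in X^trop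
    preserves the order ([trop_val_le]), rest on the same trick: negatives exist among the
    monomials, so a relation can be solved for a term of largest value, and some other term must
    then reach that value. All topologies are given by the same evaluations up to constant factors,
    so continuity both ways is formal; restricting along B -> R^mon restricts a seminorm to
    monomials, which is [trop]. *)

Lemma seq_has_max (R : realType) (I : eqType) (F : I -> R) (s : seq I) :
  s = [::] \/ exists2 m, m \in s & forall i, i \in s -> F i <= F m.
Proof.
elim: s => [|i s [->|[m ms mmax]]]; [by left|right|right].
  by exists i => [|j]; rewrite inE // => /eqP ->.
have [im|mi] := leP (F i) (F m).
  exists m; first by rewrite inE ms orbT.
  by move=> j; rewrite inE => /orP[/eqP ->|/mmax].
exists i; first by rewrite inE eqxx.
move=> j; rewrite inE => /orP[/eqP -> //|/mmax jm].
exact: le_trans jm (ltW mi).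
Qed.

Lemma nneg_gt0 (R : realType) (a : {nonneg R}) : a = 0%:nng \/ 0 < a%:num.
Proof.
have [a0|a0] := eqVneq a%:num 0; [by left; exact: val_inj|right].
by rewrite lt_neqAle eq_sym a0 ge0.
Qed.

(** * Universal property of the topology of evaluations *)

Section EvalTopology.
Variables (Y : choiceType) (I : Type) (Z : topologicalType).
Variable ev : I -> Y -> Z.

Lemma continuous_to_eval (X : topologicalType) (h : X -> eval_topology ev) :
  (forall i, continuous (ev i \o h)) -> continuous h.
Proof.
move=> hev x; apply/cvg_sup => i.
exact: (@continuous_comp_initial _ _ _ (ev i) h (hev i)).
Qed.

Lemma eval_topology_continuous i : continuous (ev i : eval_topology ev -> Z).
Proof.
move=> y.
have /cvg_sup/(_ i) id_cvg : nbhs y --> (y : eval_topology ev) by [].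
move=> U /(@initial_continuous Y Z (ev i) y) Uy.
exact: id_cvg.
Qed.

End EvalTopology.

(** * Maxima and the order of the tropical hyperfield *)

Section TropicalOrder.
Variable R : realType.
Local Notation T := (tropical R).
Implicit Types (a b c : {nonneg R}) (M : R) (x y z : m0plus (nn_monoid0 R)).

Lemma nn_num_continuous : continuous (fun a : {nonneg R} => a%:num : R).
Proof. exact: (@initial_continuous {nonneg R} R (fun a => a%:num)). Qed.

Lemma nn_mul_continuous t : continuous (fun a : {nonneg R} => nn_mul a t).
Proof.
apply: (@continuous_comp_initial _ _ _ (fun a : {nonneg R} => a%:num)).
move=> a; apply: (@continuous_comp _ _ _
  (fun a : {nonneg R} => a%:num : R) ( *%R^~ t%:num)).
  exact: nn_num_continuous.
exact: mulrr_continuous.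
Qed.

Lemma max_twice3_le a b c M : max_twice3 a b c ->
  a%:num <= M -> b%:num <= M -> c%:num <= M.
Proof.
move=> [[_ ca]|[-> _]|[-> _]] // aM _; exact: le_trans aM.
Qed.

(** For M >= 0 this does not depend on the representative, since representatives differ only by
    order and zero terms. *)
Definition fsbounded M x := forall a, a \in fsrepr x -> a%:num <= M.

Lemma fsboundedE M (s : seq {nonneg R}) : 0 <= M ->
  fsbounded M (\sum_(a <- s) @m0single (nn_monoid0 R) a) <->
  (forall a, a \in s -> a%:num <= M).
Proof.
move=> M0; rewrite -(@fsclassE (nn_monoid0 R) (m0plus_cong _) s).
have /perm_mem eqs := fsclassK (m0plus_cong (nn_monoid0 R)) s.
have {}eqs a : a != 0%:nng ->
    (a \in fsrepr (fsclass (m0plus_cong (nn_monoid0 R)) s)) = (a \in s).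
  by move=> a0; have := eqs a; rewrite !mem_filter a0.
split=> sM a; have [-> //|a0] := eqVneq a 0%:nng.
  by rewrite -eqs //; exact: sM.
by rewrite eqs //; exact: sM.
Qed.

Lemma fsboundedD M x y : 0 <= M ->
  fsbounded M (x + y) <-> fsbounded M x /\ fsbounded M y.
Proof.
move=> M0; have [s ->] := m0plus_sum x; have [t ->] := m0plus_sum y.
rewrite -big_cat !fsboundedE //; split=> [st|[sM tM] a].
  by split=> a ain; apply: st; rewrite mem_cat ain ?orbT.
by rewrite mem_cat => /orP[/sM|/tM].
Qed.

Lemma fsbounded_single M a : 0 <= M ->
  fsbounded M (@m0single (nn_monoid0 R) a) <-> a%:num <= M.
Proof.
move=> M0; have := fsboundedE [:: a] M0; rewrite big_seq1 => ->.
by split=> [|aM b]; [apply; rewrite inE|rewrite inE => /eqP ->].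
Qed.

(* Quantifying over multiples makes the comparison of maxima multiplicative. *)
Definition bound_le x y :=
  forall z M, 0 <= M -> fsbounded M (y * z) -> fsbounded M (x * z).

Lemma trop_rel_bound_le x y : trop_rel x y -> bound_le x y.
Proof.
move=> xy z M M0; have [s ->] := m0plus_sum z.
elim: s => [|a s IHs]; first by rewrite big_nil !mulr0.
rewrite big_cons !mulrDr !fsboundedD // => -[ya ys]; split; last exact: IHs.
have [b [c [d [m -> yE]]]] := (trop_rel_expanding R).1 _ _ a xy.
move: ya; rewrite yE fsboundedD // !fsbounded_single // => -[].
exact: max_twice3_le m.
Qed.

(** The order of T lies inside every admissible partial order containing the generators, so it
    suffices to exhibit one that controls maxima. *)
Lemma tropical_le_bound c (s : seq {nonneg R}) M : 0 <= M ->
  @ob_le T (@ob_incl T c) (\sum_(a <- s) @ob_incl T a) ->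
  (forall a, a \in s -> a%:num <= M) -> c%:num <= M.
Proof.
move=> M0 cs sM.
have [re an tr ad mu] := ob_le_porder T.
(* [bound_le] is blind to multiplicities, hence only a preorder; intersecting it with the order of T
   restores antisymmetry. *)
pose le (x y : m0plus (nn_monoid0 R)) := @ob_le T x y /\ bound_le x y.
have [_ /(_ 1 M M0)] : le (@m0single (nn_monoid0 R) c) (\sum_(a <- s) @m0single (nn_monoid0 R) a).
  apply: cs; first split.
  - by move=> x; split.
  - by move=> x y [xy _] [yx _]; exact: an.
  - move=> x y z [xy bxy] [yz byz]; split; first exact: tr yz.
    by move=> t N N0 /(byz t N N0); exact: bxy.
  - move=> x y z [xy bxy]; split; first exact: ad.
    move=> t N N0; rewrite !mulrDl !fsboundedD // => -[yt zt].
    by split=> //; exact: bxy.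
  - move=> x y z [xy bxy]; split; first exact: mu.
    by move=> t N N0; rewrite -!mulrA; exact: bxy.
  - move=> x y xy; split; first exact: generated_order_base.
    exact: trop_rel_bound_le.
by rewrite !mulr1 fsbounded_single // fsboundedE //; apply.
Qed.

(** Terms can be adjoined one at a time: c <= c + a is a generator when a <= c, because the maximum
    of c, a, c occurs twice. *)
Lemma tropical_le_max c (s : seq {nonneg R}) :
  (forall a, a \in s -> a%:num <= c%:num) ->
  @ob_le T (@ob_incl T c) (@ob_incl T c + \sum_(a <- s) @ob_incl T a).
Proof.
have [re an tr ad mu] := ob_le_porder T.
elim: s => [|a s IHs] sc; first by rewrite big_nil addr0; exact: re.
rewrite big_cons addrCA addrA.
apply: (tr _ (@ob_incl T c + @ob_incl T a)).
  apply: generated_order_base; exists c, a, c; split=> //.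
  by apply: Or32; split=> //; apply: sc; rewrite inE eqxx.
rewrite [X in ob_le _ (X + _)]addrC addrAC; apply: ad; apply: IHs => b bs.
by apply: sc; rewrite inE bs orbT.
Qed.

End TropicalOrder.

Lemma m0mulr1 (M : monoid0) (x : M) : m0mul x m0one = x.
Proof. by rewrite m0mulC m0mul1. Qed.

(** * T-points of a base change as morphisms extending v *)

Section TropicalPoints.
Variables (R : realType) (k : fieldType) (v : naseminorm R k) (B : oalg (mon k)).
Local Notation T := (tropical R).
Local Notation restr b x := (tpoint_eval (Trop_tens v b 1%:nng) x).
Implicit Type x : tpoints (Trop v B).

Section FromHom.
Variable p : ohom B T.
Hypothesis pv : forall c : k, p (oa_str B c) = v c.

Definition tpoint_hom : ohom (Trop v B) T :=
  @tens_rec _ _ _ (oa_str B) (seminorm_hom v) T p (oid T) pv.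

Fact tpoint_hom_lin t : tpoint_hom (oa_str (Trop v B) t) = t.
Proof. by rewrite [LHS]tens_recE oh1 m0mul1. Qed.

Definition tpoint_of : tpoints (Trop v B) :=
  @OHomK T (Trop v B) (oalg_self T) tpoint_hom tpoint_hom_lin.

Lemma tpoint_ofE b t :
  tpoint_eval (Trop_tens v b t) tpoint_of = nn_mul (p b) t.
Proof.
exact: (@tens_recE _ _ _ (oa_str B) (seminorm_hom v) T p (oid T) pv).
Qed.

End FromHom.

(** Factor b tensor t as (b tensor 1)(1 tensor t); T-linearity fixes the value of the second
    factor. *)
Lemma tpoint_evalE x b t :
  tpoint_eval (Trop_tens v b t) x = nn_mul (restr b x) t.
Proof.
have xt : x (oa_str (Trop v B) t) = t := ohk_lin x t.
rewrite -[in RHS]xt -[RHS](ohM x); congr (ohk_hom x _).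
by rewrite -[RHS]tensM m0mulr1; congr tens; rewrite [RHS]m0mul1.
Qed.

Lemma tpointP x y : (forall b : B, restr b x = restr b y) -> x = y.
Proof.
move=> xy; apply: ohomKP => b; have [c [t ->]] := tensE b.
by have := tpoint_evalE x c t; rewrite xy -tpoint_evalE.
Qed.

Lemma tpoint_eval_base x c : restr (oa_str B c) x = v c.
Proof.
rewrite /tpoint_eval /Trop_tens -[1%:nng]/(@m0one T) tens_base.
exact: (ohk_lin x (v c)).
Qed.

Lemma tpoint_eval1 x : restr m0one x = 1%:nng.
Proof. by rewrite -(oh1 (oa_str B)) tpoint_eval_base; exact: sn1. Qed.

Lemma tpoint_eval0 x : restr m0zero x = 0%:nng.
Proof. by rewrite -(oh0 (oa_str B)) tpoint_eval_base; exact: sn0. Qed.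

Lemma tpoint_evalM x (a b : B) :
  restr (m0mul a b) x = nn_mul (restr a x) (restr b x).
Proof.
rewrite -[RHS](ohM x); congr (ohk_hom x _).
by rewrite -[RHS]tensM; congr tens; rewrite [RHS]m0mul1.
Qed.

(** Composing x with B -> B tensor T carries the relation into T, where [tropical_le_bound]
    applies. *)
Lemma tpoint_eval_le x (b : B) (s : seq B) (M : R) : 0 <= M ->
  @ob_le B (ob_incl b) (\sum_(d <- s) ob_incl d) ->
  (forall d, d \in s -> (restr d x)%:num <= M) -> (restr b x)%:num <= M.
Proof.
move=> M0 bs sM.
have [g [gE gle]] := oh_ext (ocomp x (tens_inl (oa_str B) (seminorm_hom v))).
have := gle _ _ bs; rewrite rmorph_sum gE.
under eq_bigr do rewrite gE.
rewrite -[X in ob_le _ X](big_map (fun d => restr d x) predT (@ob_incl T)).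
move=> /(tropical_le_bound M0); apply=> _ /mapP[d ds ->]; exact: sM.
Qed.

Lemma tpoint_eval_dominated x (b : B) (s : seq B) :
  @ob_le B (ob_incl b) (\sum_(d <- s) ob_incl d) -> 0 < (restr b x)%:num ->
  exists2 d, d \in s & (restr b x)%:num <= (restr d x)%:num.
Proof.
move=> bs b0; have [s0|[m ms mmax]] := seq_has_max (fun d => (restr d x)%:num) s.
  have : (restr b x)%:num <= 0 by apply: (tpoint_eval_le _ bs); rewrite ?s0.
  by rewrite leNgt b0.
by exists m => //; exact: tpoint_eval_le bs mmax.
Qed.

Lemma continuous_to_tpoints (X : topologicalType) (h : X -> tpoints (Trop v B)) :
  (forall b : B, continuous (fun y => restr b (h y))) -> continuous h.
Proof.
move=> hb; apply: (@continuous_to_eval _ _ _ (@tpoint_eval R (Trop v B))) => b.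
have [c [t ->]] := tensE b.
rewrite [_ \o _](_ : _ = (fun a => nn_mul a t) \o (fun y => restr c (h y))).
  by move=> y; apply: continuous_comp; [exact: hb|exact: nn_mul_continuous].
by apply: funext => y; exact: tpoint_evalE.
Qed.

Lemma tpoint_eval_continuous (b : Trop v B) : continuous (@tpoint_eval R _ b).
Proof. exact: (@eval_topology_continuous _ _ _ (@tpoint_eval R (Trop v B))). Qed.

End TropicalPoints.

(** * The Berkovich space as a space of T-points *)

Section Analytic.
Variables (R : realType) (k : fieldType) (v : naseminorm R k).
Variables (S : comPzRingType) (kS : {rmorphism k -> S}).
Local Notation Xan := (analytification v kS).
Local Notation Y := (tpoints (Trop v (mon_algebra kS))).

Lemma naseminormP (w w' : naseminorm R S) : (forall a, w a = w' a) -> w = w'.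
Proof.
case: w w' => [w ? ? ? ?] [w' ? ? ? ?] /= /funext ww'.
by subst w'; congr NASeminorm; exact: Prop_irrelevance.
Qed.

Lemma analytificationP (w w' : Xan) : (forall a, w a = w' a) -> w = w'.
Proof.
case: w w' => [w we] [w' we'] /= /naseminormP ww'; subst w'.
by rewrite (Prop_irrelevance we we').
Qed.

Definition Phi_an (w : Xan) : Y :=
  @tpoint_of R k v (mon_algebra kS) (seminorm_hom w) (an_extends w).

Lemma Phi_anE w (r : S) t :
  tpoint_eval (Trop_tens v (B := mon_algebra kS) r t) (Phi_an w) = nn_mul (w r) t.
Proof. exact: tpoint_ofE. Qed.

Section Inverse.
Variable x : Y.

Definition an_fun (r : S) : {nonneg R} :=
  tpoint_eval (Trop_tens v (B := mon_algebra kS) r 1%:nng) x.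

Fact an_fun0 : an_fun 0 = 0%:nng. Proof. exact: tpoint_eval0. Qed.
Fact an_fun1 : an_fun 1 = 1%:nng. Proof. exact: tpoint_eval1. Qed.
Fact an_funM a b : an_fun (a * b) = nn_mul (an_fun a) (an_fun b).
Proof. exact: tpoint_evalM. Qed.
Fact an_funD a b :
  (an_fun (a + b))%:num <= Num.max (an_fun a)%:num (an_fun b)%:num.
Proof.
apply: (@tpoint_eval_le _ _ _ (mon_algebra kS) x (a + b) [:: a; b]).
- by rewrite le_max ge0.
(* On the left a + b is one element of the ring, on the right a formal sum: this is a generator of
   R^mon. *)
- rewrite !big_cons big_nil addr0; apply: generated_order_base.
  by exists a, b, (a + b).
- by move=> d; rewrite !inE le_max => /orP[]/eqP ->; rewrite lexx ?orbT.
Qed.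

Definition an_of_tpoint : Xan := @Analytification R k v S kS
  (NASeminorm an_fun0 an_fun1 an_funM an_funD)
  (@tpoint_eval_base _ _ _ (mon_algebra kS) x).

End Inverse.

Lemma Phi_an_homeomorphism : homeomorphism Phi_an.
Proof.
split.
  apply: continuous_to_tpoints => b.
  rewrite [X in continuous X](_ : _ = fun w : Xan => w b).
    exact: (@eval_topology_continuous _ _ _ (fun (a : S) (w : Xan) => w a)).
  by apply: funext => w; rewrite Phi_anE nn_mulC nn_mul1.
exists an_of_tpoint; split.
- move=> w; apply: analytificationP => a.
  by rewrite [LHS]Phi_anE nn_mulC nn_mul1.
- by move=> x; apply: tpointP => b; rewrite Phi_anE nn_mulC nn_mul1.
- apply: (@continuous_to_eval _ _ _ (fun (a : S) (w : Xan) => w a)) => a.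
  exact: tpoint_eval_continuous.
Qed.

End Analytic.

(** * The morphism from B to T defined by a point of X^trop *)

Section CharacterTerm.
Variables (R : realType) (k : fieldType) (v : naseminorm R k).
Variables (A : monoidType) (f : character R A).

Definition char_term (c : k) (a : A) : {nonneg R} := nn_mul (v c) (f a).

Lemma char_term0 a : char_term 0 a = 0%:nng.
Proof. by rewrite /char_term sn0 nn_mul0. Qed.

Lemma char_termN c a : char_term (- c) a = char_term c a.
Proof. by rewrite /char_term snN. Qed.

Lemma char_termM c d a b :
  char_term (c * d) (a * b)%g = nn_mul (char_term c a) (char_term d b).
Proof. by rewrite /char_term snM chM; apply: val_inj; rewrite /= mulrACA. Qed.

Lemma char_term_lt (M : R) c d a : (char_term c a)%:num < M ->
  (char_term d a)%:num < M -> (char_term (c + d) a)%:num < M.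
Proof.
have := snD v c d; rewrite le_max /char_term /=.
by move=> /orP[] h ? ?; apply: (le_lt_trans (ler_wpM2r _ h)).
Qed.

(** Terms of l with the same exponent merge into one coefficient, which the ultrametric inequality
    keeps below M. *)
Lemma char_term_sum_lt (M : R) (l : seq (k * A)) x : 0 < M ->
  (forall t, t \in l -> (char_term t.1 t.2)%:num < M) ->
  (char_term (macoef (\sum_(t <- l) monom t.1 t.2) x) x)%:num < M.
Proof.
move=> M0; elim: l => [|t l IHl] lM; first by rewrite big_nil macoef0 char_term0.
rewrite big_cons macoefD; apply: char_term_lt; last first.
  by apply: IHl => u ul; apply: lM; rewrite inE ul orbT.
rewrite macoef_monom; case: eqP => [->|_]; last by rewrite char_term0.
by apply: lM; rewrite inE eqxx.
Qed.

Variables (S : comPzRingType) (kS : {rmorphism k -> S}).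
Variable iota : toric_immersion kS A.
Hypothesis ftrop : tropicalization v iota f.

(* If the left-hand term strictly dominated, its exponent would be the only   *)
(* one to attain the maximum in the relation obtained by subtraction, even    *)
(* when exponents repeat in l, because v is nonarchimedean.                   *)
Lemma char_term_dominated c a (l : seq (k * A)) :
  iota (monom c a) = \sum_(t <- l) iota (monom t.1 t.2) ->
  0 < (char_term c a)%:num ->
  exists2 t, t \in l & (char_term c a)%:num <= (char_term t.1 t.2)%:num.
Proof.
move=> cal M0; apply: contrapT => no_t.
set M := (char_term c a)%:num in M0 no_t.
pose q : monalg k A := \sum_(t <- l) monom t.1 t.2.
pose p := monom c a - q.
have p0 : iota p = 0 by rewrite rmorphB cal rmorph_sum subrr.
have q_lt x : (char_term (macoef q x) x)%:num < M.
  apply: char_term_sum_lt => // t tl; rewrite ltNge; apply/negP => Mt.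
  by apply: no_t; exists t.
have p_lt x : x <> a -> (char_term (macoef p x) x)%:num < M.
  move=> /eqP/negPf xa.
  by rewrite macoefD macoefN macoef_monom xa add0r char_termN.
(* Since c is the sum of the coefficients of p and q at a, a small coefficient of p there would make
   M < M. *)
have pa_ge : ~ (char_term (macoef p a) a)%:num < M.
  move=> pa; have := char_term_lt pa (q_lt a).
  by rewrite macoefD macoefN macoef_monom eqxx subrK ltxx.
have [[x [y [xy Exy ub]]]|all0] := ftrop p0; last first.
  by apply: pa_ge; rewrite /char_term all0.
(* One of the distinct exponents x, y differs from a, so the common maximum lies below M, against
   [pa_ge]. *)
have [xa|/eqP xa] := eqVneq x a; last exact/pa_ge/(le_lt_trans (ub a))/p_lt.
apply: pa_ge; apply: (le_lt_trans (ub a)).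
by rewrite Exy; apply: p_lt => ya; apply: xy; rewrite xa ya.
Qed.

(** An equality of monomials is a one-term relation; dominance in both directions makes the value
    independent of the presentation. *)
Lemma char_term_eq c a d b :
  iota (monom c a) = iota (monom d b) -> char_term c a = char_term d b.
Proof.
have le c' a' d' b' : iota (monom c' a') = iota (monom d' b') ->
    (char_term c' a')%:num <= (char_term d' b')%:num.
  move=> E; have [->|ca0] := nneg_gt0 (char_term c' a'); first exact: ge0.
  have [|t] := @char_term_dominated c' a' [:: (d', b')] _ ca0.
    by rewrite big_seq1.
  by rewrite inE => /eqP ->.
by move=> E; apply/val_inj/eqP; rewrite eq_le !le.
Qed.

Definition B_dec (b : B_bullet iota) :
  {ca : k * A | B_val b = iota (monom ca.1 ca.2)}.
Proof. by apply: cid; have [c [a bE]] := set_valP b; exists (c, a). Qed.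

Definition B_opp (b : B_bullet iota) : B_bullet iota :=
  B_elt iota (- (sval (B_dec b)).1) (sval (B_dec b)).2.

Lemma B_val_opp b : B_val (B_opp b) = - B_val b.
Proof.
rewrite [in RHS](svalP (B_dec b)) -rmorphN; congr (iota _).
by apply: monalgP => x; rewrite macoefN !macoef_monom; case: eqP; rewrite ?oppr0.
Qed.

Definition trop_val (b : B_bullet iota) : {nonneg R} :=
  char_term (sval (B_dec b)).1 (sval (B_dec b)).2.

Lemma trop_valE b c a : B_val b = iota (monom c a) -> trop_val b = char_term c a.
Proof. by rewrite (svalP (B_dec b)) => /char_term_eq. Qed.

Lemma trop_val_opp b : trop_val (B_opp b) = trop_val b.
Proof. by rewrite (trop_valE (erefl (B_val (B_opp b)))) char_termN. Qed.

Lemma trop_val_dominated b (s : seq (B_bullet iota)) :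
  B_val b = \sum_(d <- s) B_val d -> 0 < (trop_val b)%:num ->
  exists2 d, d \in s & (trop_val b)%:num <= (trop_val d)%:num.
Proof.
move=> bs b0.
have [|_ /mapP[d ds ->] bd] := @char_term_dominated _ _
    [seq sval (B_dec d) | d <- s] _ b0; last by exists d.
by rewrite big_map -(svalP (B_dec b)) bs; apply: eq_bigr => d _; exact: (svalP (B_dec d)).
Qed.

Lemma trop_val0 : trop_val m0zero = 0%:nng.
Proof. by rewrite (@trop_valE _ 0 1%g) ?char_term0 // monom0 rmorph0. Qed.

Lemma trop_val1 : trop_val m0one = 1%:nng.
Proof.
rewrite (@trop_valE _ 1 1%g) ?monom1E ?rmorph1 //.
by rewrite /char_term sn1 ch1 nn_mul1.
Qed.

Lemma trop_valM b d : trop_val (m0mul b d) = nn_mul (trop_val b) (trop_val d).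
Proof.
rewrite -char_termM; apply: trop_valE.
by rewrite -monomM rmorphM -!(svalP (B_dec _)).
Qed.

Local Notation T := (tropical R).

(** Let m be a term of s of largest value. If b ties with m, adjoin the other terms by
    [tropical_le_max]; if b is smaller, a second term must tie with m. *)
Lemma trop_val_le b (s : seq (B_bullet iota)) :
  B_val b = \sum_(d <- s) B_val d ->
  @ob_le T (@ob_incl T (trop_val b)) (\sum_(d <- s) @ob_incl T (trop_val d)).
Proof.
have [re _ tr ad _] := ob_le_porder T.
have le_max b' (s' : seq (B_bullet iota)) :
    (forall d, d \in s' -> (trop_val d)%:num <= (trop_val b')%:num) ->
    @ob_le T (@ob_incl T (trop_val b'))
      (@ob_incl T (trop_val b') + \sum_(d <- s') @ob_incl T (trop_val d)).
  move=> s'b; rewrite -(big_map trop_val predT (@ob_incl T)).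
  by apply: tropical_le_max => _ /mapP[d ds ->]; exact: s'b.
move=> bs; have [s0|[m ms mmax]] := seq_has_max (fun d => (trop_val d)%:num) s.
  have [->|] := nneg_gt0 (trop_val b).
    rewrite s0 big_nil -[0%:nng]/(@m0zero T) ob_incl0; exact: re.
  by move=> /(trop_val_dominated bs)[d]; rewrite s0.
have bm : (trop_val b)%:num <= (trop_val m)%:num.
  have [->|b0] := nneg_gt0 (trop_val b); first exact: ge0.
  by have [d /mmax dm bd] := trop_val_dominated bs b0; exact: le_trans dm.
have sE := perm_to_rem ms.
have rem_le d : d \in rem m s -> (trop_val d)%:num <= (trop_val m)%:num.
  by move=> /mem_rem; exact: mmax.
rewrite (perm_big _ sE) big_cons; move: bm; rewrite le_eqVlt => /orP[/eqP bm|bm].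
  have -> : trop_val b = trop_val m by exact: val_inj.
  exact: le_max.
have m0 : 0 < (trop_val m)%:num by apply: le_lt_trans bm.
(* Solve the relation for m. The term dominating m cannot be b, so it is the opposite of some e in
   the rest of s. *)
have mE : B_val m = \sum_(d <- b :: map B_opp (rem m s)) B_val d.
  rewrite big_cons big_map bs (perm_big _ sE) big_cons -addrA -big_split /=.
  by rewrite big1 ?addr0 // => d _; rewrite B_val_opp subrr.
have [d] := trop_val_dominated mE m0.
rewrite inE => /orP[/eqP ->|/mapP[e es ->]]; first by rewrite leNgt bm.
rewrite trop_val_opp => me.
have {}me : trop_val e = trop_val m.
  by apply/val_inj/eqP; rewrite eq_le rem_le.
rewrite (perm_big _ (perm_to_rem es)) big_cons me.
(* The value of b is below m + m as the maximum m occurs twice; the remaining terms are then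
   adjoined to one copy of m. *)
apply: (tr _ (@ob_incl T (trop_val m) + @ob_incl T (trop_val m))).
  apply: generated_order_base; exists (trop_val m), (trop_val m), (trop_val b).
  by split=> //; apply: Or31; split=> //; exact: ltW.
rewrite [X in ob_le _ X]addrC.
apply: ad; apply: le_max => d' /mem_rem; exact: rem_le.
Qed.

Fact trop_val_rel x y : @B_rel _ _ _ _ iota x y -> exists s t : seq (B_bullet iota),
  [/\ x = \sum_(a <- s) m0single a, y = \sum_(a <- t) m0single a
    & @ob_le T (\sum_(a <- s) @ob_incl T (trop_val a))
               (\sum_(a <- t) @ob_incl T (trop_val a))].
Proof.
move=> [b [s [bs -> ->]]]; exists [:: b], s; rewrite !big_seq1; split=> //.
exact: trop_val_le.
Qed.

Definition trop_hom : ohom (B_blueprint iota) T :=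
  @free_ohom _ _ (B_rel_expanding iota) T trop_val trop_val0 trop_val1 trop_valM
    trop_val_rel.

Fact trop_hom_base c : trop_hom (oa_str (B_algebra iota) c) = v c.
Proof.
rewrite -[LHS]/(trop_val _) (@trop_valE _ c 1%g); last by rewrite ti_linear.
by rewrite /char_term ch1 nn_mulC nn_mul1.
Qed.

End CharacterTerm.

(** * The Kajiwara-Payne tropicalization as a space of T-points *)

Section Tropicalization.
Variables (R : realType) (k : fieldType) (v : naseminorm R k).
Variables (S : comPzRingType) (kS : {rmorphism k -> S}).
Variables (A : monoidType) (iota : toric_immersion kS A).
Local Notation Xtrop := (tropicalization v iota).
Local Notation Y := (tpoints (Trop v (B_algebra iota))).

Lemma characterP (f g : character R A) : (forall a, f a = g a) -> f = g.
Proof.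
case: f g => [f f1 fM] [g g1 gM] /= /funext fg; subst g.
by rewrite (Prop_irrelevance f1 g1) (Prop_irrelevance fM gM).
Qed.

Definition Phi_trop (f : Xtrop) : Y :=
  @tpoint_of R k v (B_algebra iota) (trop_hom (set_valP f))
    (trop_hom_base (set_valP f)).

Lemma Phi_tropE f (b : B_bullet iota) t :
  tpoint_eval (Trop_tens v (B := B_algebra iota) b t) (Phi_trop f) =
  nn_mul (trop_val v (set_val f) b) t.
Proof. exact: tpoint_ofE. Qed.

Lemma Phi_trop_elt f c a t :
  tpoint_eval (Trop_tens v (B_elt iota c a) t) (Phi_trop f) =
  nn_mul (nn_mul (v c) (set_val f a)) t.
Proof. by rewrite Phi_tropE (trop_valE (set_valP f) (erefl (B_val (B_elt iota c a)))). Qed.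

Section Inverse.
Variable x : Y.

Definition trop_fun (a : A) : {nonneg R} :=
  tpoint_eval (Trop_tens v (B_elt iota 1 a) 1%:nng) x.

Lemma trop_fun_elt c a :
  tpoint_eval (Trop_tens v (B_elt iota c a) 1%:nng) x = nn_mul (v c) (trop_fun a).
Proof.
have -> : B_elt iota c a = m0mul (oa_str (B_algebra iota) c) (B_elt iota 1 a).
  by apply: val_inj; exact: ti_monom.
by rewrite tpoint_evalM tpoint_eval_base.
Qed.

Fact tpoint_trop_fun1 : trop_fun 1%g = 1%:nng.
Proof.
rewrite -[RHS](tpoint_eval1 x); congr (tpoint_eval (Trop_tens v _ _) x).
by apply: val_inj; rewrite /= monom1E rmorph1.
Qed.

Fact tpoint_trop_funM a b :
  trop_fun (a * b)%g = nn_mul (trop_fun a) (trop_fun b).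
Proof.
rewrite -tpoint_evalM; congr (tpoint_eval (Trop_tens v _ _) x).
by apply: val_inj; rewrite /= -rmorphM monomM mulr1.
Qed.

Definition tpoint_char : character R A :=
  Character tpoint_trop_fun1 tpoint_trop_funM.

(** Solving p = 0 in R for a monomial m of maximal value gives a generator of the order of B;
    evaluated at x, it yields a second monomial reaching the maximum. *)
Fact tpoint_char_in : tpoint_char \in Xtrop.
Proof.
apply/mem_set => p /= p0.
pose F a := nn_mul (v (macoef p a)) (trop_fun a).
have Fout a : a \notin masupp p -> F a = 0%:nng.
  by move=> /macoef_out pa; rewrite /F pa sn0 nn_mul0.
have [all0|/existsNP[a0 Fa0]] := pselect (forall a, F a = 0%:nng); first by right.
have {}Fa0 : 0 < (F a0)%:num by case: (nneg_gt0 (F a0)).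
have [sp0|[m mp mmax]] := seq_has_max (fun a => (F a)%:num) (masupp p).
  move: Fa0; rewrite Fout ?ltxx //; apply/negP.
  by rewrite -[_ \in _]/(a0 \in enum_fset _) sp0.
have Fm_max a : (F a)%:num <= (F m)%:num.
  have [/mmax //|/Fout ->] := boolP (a \in masupp p); exact: ge0.
left; exists m.
pose s : seq (B_bullet iota) :=
  [seq B_elt iota (- macoef p a) a | a <- (masupp p `\ m)%fset].
have mE : B_val (B_elt iota (macoef p m) m) = \sum_(d <- s) B_val d.
  rewrite big_map /=; apply/eqP; rewrite -subr_eq0 -sumrN; apply/eqP.
  rewrite -[RHS]p0 [in RHS](monalgE p) rmorph_sum [RHS](big_fsetD1 m) //=.
  congr (_ + _).
  apply: eq_bigr => a _; rewrite -rmorphN; congr (iota _).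
  apply: monalgP => y; rewrite macoefN !macoef_monom.
  by case: eqP; rewrite ?opprK ?oppr0.
have [||d /mapP[a]] := @tpoint_eval_dominated _ _ _ (B_algebra iota) x
  (B_elt iota (macoef p m) m) s.
- by apply: generated_order_base; exists (B_elt iota (macoef p m) m), s.
- by rewrite trop_fun_elt; apply: lt_le_trans (Fm_max a0).
rewrite !inE => /andP[am _] ->; rewrite !trop_fun_elt snN => ma.
exists a; split=> //; first by apply/eqP; rewrite eq_sym.
by apply/val_inj/eqP; rewrite eq_le ma; exact: Fm_max.
Qed.

Definition trop_of_tpoint : Xtrop := exist _ tpoint_char tpoint_char_in.

End Inverse.

Lemma character_eval_continuous a : continuous (fun f : character R A => f a).
Proof.
exact: (@eval_topology_continuous _ _ _ (fun (a : A) (f : character R A) => f a) a).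
Qed.

Lemma set_val_eval_continuous a : continuous (fun f : Xtrop => set_val f a).
Proof.
move=> f; apply: (@continuous_comp _ _ _ (set_val : Xtrop -> character R A)
  (fun g : character R A => g a)).
  exact: (@initial_continuous Xtrop (character R A) set_val).
exact: (@character_eval_continuous a).
Qed.

Lemma Phi_trop_homeomorphism : homeomorphism Phi_trop.
Proof.
split.
  apply: continuous_to_tpoints => b; have [c [a bE]] := set_valP b.
  have -> : b = B_elt iota c a by exact: val_inj.
  rewrite [X in continuous X](_ : _ =
      (fun y => nn_mul y (v c)) \o (fun f : Xtrop => set_val f a)).
    move=> f; apply: continuous_comp; last exact: nn_mul_continuous.
    exact: set_val_eval_continuous.
  by apply: funext => f; rewrite Phi_trop_elt /= nn_mulC nn_mul1 nn_mulC.
exists trop_of_tpoint; split.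
- move=> f; apply: val_inj; apply: characterP => a.
  by rewrite [LHS]Phi_trop_elt sn1 nn_mul1 nn_mulC nn_mul1.
- move=> x; apply: tpointP => b; have [c [a bE]] := set_valP b.
  have -> : b = B_elt iota c a by exact: val_inj.
  by rewrite Phi_trop_elt trop_fun_elt [LHS]nn_mulC nn_mul1.
- apply: (@continuous_comp_initial _ _ _ (set_val : Xtrop -> character R A)).
  apply: (@continuous_to_eval _ _ _ (fun a (g : character R A) => g a)) => a.
  exact: tpoint_eval_continuous.
Qed.

End Tropicalization.

(** * Compatibility of the two homeomorphisms *)

Theorem theorem3p5 (R : realType) (k : fieldType) (v : naseminorm R k)
    (S : comPzRingType) (kS : {rmorphism k -> S})
    (A : monoidType) (hA : toric_monoid A) (iota : toric_immersion kS A) :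
  exists (Phi_an : analytification v kS -> tpoints (Trop v (mon_algebra kS)))
         (Phi_trop : tropicalization v iota -> tpoints (Trop v (B_algebra iota))),
    [/\ homeomorphism Phi_an /\
        (forall w (r : S) (t : {nonneg R}),
           tpoint_eval (Trop_tens v (B := mon_algebra kS) r t) (Phi_an w) =
           nn_mul (w r) t),
        homeomorphism Phi_trop /\
        (forall f (c : k) (a : A) (t : {nonneg R}),
           tpoint_eval (Trop_tens v (B_elt iota c a) t) (Phi_trop f) =
           nn_mul (nn_mul (v c) (set_val f a)) t)
      & forall w, beta_star v iota (Phi_an w) = Phi_trop (trop iota w)].
Proof.
exists (@Phi_an R k v S kS), (@Phi_trop R k v S kS A iota); split.
- by split; [exact: Phi_an_homeomorphism|exact: Phi_anE].
- by split; [exact: Phi_trop_homeomorphism|exact: Phi_trop_elt].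
(* It suffices to compare values at iota(c a) tensor 1, where both sides give v(c) w(iota(a)). *)
move=> w; apply: tpointP => b; have [c [a bE]] := set_valP b.
have -> : b = B_elt iota c a by exact: val_inj.
have -> : tpoint_eval (Trop_tens v (B_elt iota c a) 1%:nng)
    (beta_star v iota (Phi_an w)) =
  tpoint_eval (Trop_tens v (B := mon_algebra kS) (iota (monom c a)) 1%:nng)
    (Phi_an w).
  congr (ohk_hom (Phi_an w) _).
  exact: (base_change_mapE (seminorm_hom v) (B_incl iota) (B_elt iota c a)).
by rewrite Phi_anE Phi_trop_elt ti_monom snM an_extends.
Qed.
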